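(* Let $S$ be a semitopological semigroup. Then $AP(S)$, the space of continuous almost periodic functions on $S$, has a left invariant mean if and only if $S$ has the following fixed point property: $(E)$: Whenever $S$ acts on a nonempty weakly compact convex subset $K$ of a Banach space and the action is weakly separately continuous, weakly equicontinuous and nonexpansive, then $K$ contains a common fixed point for $S$, i.e. an element $x\in K$ with $s\cdot x=x$ for every $s\in S$.
   Context: A semitopological semigroup is a semigroup $S$ with a Hausdorff topology such that for each $t\in S$ the mappings $s\mapsto ts$ and $s\mapsto st$ from $S$ to $S$ are continuous. $\ell^\infty(S)$ is the Banach space of bounded complex-valued functions on $S$ with the supremum norm, and $C(S)$ is its closed subalgebra of bounded continuous functions. For $s\in S$ and $f\in\ell^\infty(S)$, the left translation is $l_sf(t)=f(st)$, $t\in S$. A function $f\in C(S)$ is almost periodic if $\{l_sf:s\in S\}$ is relatively compact in the norm topology of $C(S)$; $AP(S)$ is the space of all such functions. A left invariant mean (LIM) on a closed linear translation-invariant subspace $X$ of $\ell^\infty(S)$ containing the constants is a functional $m\in X^*$ with $\|m\|=m(1)=1$ and $m(l_sf)=m(f)$ for all $s\in S$, $f\in X$. An action of $S$ on $K$ (from the left) is a map $S\times K\to K$, $(s,x)\mapsto s\cdot x$, with $s\cdot(s'\cdot x)=(ss')\cdot x$ for all $s,s'\in S$, $x\in K$. For $K$ a subset of a Banach space $E$, the action is: nonexpansive if $\|s\cdot x-s\cdot y\|\le\|x-y\|$ for all $x,y\in K$, $s\in S$; weakly separately continuous if, when $K$ carries the weak topology of $E$, the map $(s,x)\mapsto s\cdot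 x$ is continuous in each variable when the other is fixed; weakly equicontinuous if, when $K$ carries the weak topology of $E$, the family of maps $\{x\mapsto s\cdot x\}_{s\in S}$ from $K$ to $K$ is equicontinuous in the usual sense (with respect to the weak uniformity). *)

(* Defs.v *)
From HB Require Import structures.
From mathcomp Require Import all_boot all_order all_algebra.
From mathcomp Require Import complex.
From mathcomp Require Import all_classical all_reals all_analysis.

Set Implicit Arguments.
Unset Strict Implicit.
Unset Printing Implicit Defensive.

Import Order.TTheory GRing.Theory Num.Theory.
Import ComplexField.Normc.
Import numFieldNormedType.Exports.

Local Open Scope classical_set_scope.
Local Open Scope ring_scope.

HB.mixin Record isSemitopologicalSemigroup S & Topological S & Semigroup S := {
  semitop_hausdorff : hausdorff_space S;
  semitop_mull_continuous : forall t : S, continuous (fun s : S => (t * s)%g);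
  semitop_mulr_continuous : forall t : S, continuous (fun s : S => (s * t)%g)
}.

#[short(type="semitopologicalSemigroupType")]
HB.structure Definition SemitopologicalSemigroup :=
  {S of Topological S & Semigroup S & isSemitopologicalSemigroup S}.

Section linf.
Variables (R : realType) (S : Type).

Definition linf_pred : {pred S -> R[i]^o} :=
  fun f => `[< exists M : R, forall s, normc (f s) <= M >].

Lemma linf_submod_closed : submod_closed linf_pred.
Proof.
split.
  by apply/asboolP; exists 0 => s; rewrite normc0.
move=> a f g /asboolP[M fM] /asboolP[N gN]; apply/asboolP.
exists (normc a * M + N) => s.
rewrite (le_trans (le_normcD _ _))// lerD// normcM ler_wpM2l//.
by case: (a) => x y; rewrite sqrtr_ge0.
Qed.

HB.instance Definition _ :=
  GRing.isSubmodClosed.Build _ _ linf_pred linf_submod_closed.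

Record linf := Linf {linf_fun :> S -> R[i]^o; _ : linf_fun \in linf_pred}.

HB.instance Definition _ := [isSub for linf_fun].
HB.instance Definition _ := [Choice of linf by <:].
HB.instance Definition _ := [SubChoice_isSubLmodule of linf by <:].

Definition sup_normr (f : linf) : R := sup (range (fun s => normc (f s))).

(* Norms in a normedModType over R[i] take their values in R[i], hence the
   injection of the real supremum into R[i]. *)
Definition sup_norm (f : linf) : R[i] := (sup_normr f)%:C%C.

End linf.

Section linf_normed.
Variables (R : realType) (S : Type).
Implicit Types f g : linf R S.

Lemma normc_ge0 (z : R[i]) : 0 <= normc z.
Proof. by case: z => x y; exact: sqrtr_ge0. Qed.

Lemma linfP f : exists M : R, forall s, normc (f s) <= M.
Proof. by case: f => f fP; apply/asboolP. Qed.

Lemma normc_le_sup f s : normc (f s) <= sup_normr f.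
Proof.
apply: ub_le_sup; last by exists s.
by have [M fM] := linfP f; exists M => _ [t _ <-].
Qed.

Lemma sup_normr_ge0 f : 0 <= sup_normr f.
Proof.
have [[s _]|S0] := pselect (exists s : S, True).
  exact: le_trans (normc_ge0 _) (normc_le_sup f s).
rewrite /sup_normr sup_out// => -[[_ [s _ _]] _]; exact: S0 (ex_intro _ s I).
Qed.

Lemma sup_normr_le f (M : R) : 0 <= M -> (forall s, normc (f s) <= M) ->
  sup_normr f <= M.
Proof.
move=> M0 fM; have [[s _]|S0] := pselect (exists s : S, True).
  by apply: ge_sup => [|_ [t _ <-]//]; exists (normc (f s)), s.
rewrite /sup_normr sup_out// => -[[_ [s _ _]] _]; exact: S0 (ex_intro _ s I).
Qed.

Lemma sup_norm_ler_normD f g : sup_norm (f + g) <= sup_norm f + sup_norm g.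
Proof.
rewrite /sup_norm -rmorphD/= lecR; apply: sup_normr_le => [|s].
  by rewrite addr_ge0// sup_normr_ge0.
by rewrite (le_trans (le_normcD _ _))// lerD// normc_le_sup.
Qed.

Lemma sup_norm_leZ (a : R[i]) f : sup_normr (a *: f) <= normc a * sup_normr f.
Proof.
apply: sup_normr_le => [|s].
  by rewrite mulr_ge0// ?normc_ge0// sup_normr_ge0.
by rewrite /= normcM ler_wpM2l ?normc_ge0// normc_le_sup.
Qed.

Lemma sup_norm_normrZ (a : R[i]) f : sup_norm (a *: f) = `|a| * sup_norm f.
Proof.
have -> : `|a| = (normc a)%:C%C by [].
rewrite /sup_norm -rmorphM/=; congr (_%:C%C); apply/eqP.
rewrite eq_le sup_norm_leZ/=.
have [->|a0] := eqVneq a 0; first by rewrite normc0 mul0r sup_normr_ge0.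
have na0 : 0 < normc a.
  rewrite lt_neqAle normc_ge0 andbT eq_sym.
  by apply: contra a0 => /eqP/eq0_normc->.
rewrite -ler_pdivlMl// -normcV.
by have := sup_norm_leZ a^-1 (a *: f); rewrite scalerA mulVf// scale1r.
Qed.

Lemma sup_norm_eq0 f : sup_norm f = 0 -> f = 0.
Proof.
move=> [f0]; apply/val_inj/funext => s /=; apply: eq0_normc.
by apply/eqP; rewrite eq_le normc_ge0 andbT -[leRHS]f0 normc_le_sup.
Qed.

HB.instance Definition _ := @Lmodule_isNormed.Build R[i] (linf R S) (@sup_norm R S)
  sup_norm_ler_normD sup_norm_normrZ sup_norm_eq0.

Lemma linf_cst_subproof (c : R[i]) : (fun=> c) \in @linf_pred R S.
Proof. by apply/asboolP; exists (normc c). Qed.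

Definition linf_cst (c : R[i]) : linf R S := Linf (linf_cst_subproof c).

End linf_normed.

Section translation.
Variables (R : realType) (S : semigroupType).

Lemma ltransl_subproof (s : S) (f : linf R S) :
  (fun t => f (s * t)%g) \in @linf_pred R S.
Proof. by have [M fM] := linfP f; apply/asboolP; exists M. Qed.

Definition ltransl (s : S) (f : linf R S) : linf R S :=
  Linf (ltransl_subproof s f).

(* The norm of the restriction of m to the subspace X, as an element of X^*. *)
Definition functional_norm (X : set (linf R S)) (m : linf R S -> R[i]) : \bar R :=
  ereal_sup [set (normc (m f))%:E | f in X `&` [set f | `|f| <= 1]].

(* Only the values of m on X matter. *)
Record left_invariant_mean (X : set (linf R S)) (m : linf R S -> R[i]) : Prop := {
  mean_linear : forall (a : R[i]) (f g : linf R S), X f -> X g ->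
    m (a *: f + g) = a * m f + m g;
  mean_norm : functional_norm X m = 1%:E;
  mean_one : m (linf_cst S 1) = 1;
  mean_invariant : forall (s : S) (f : linf R S), X f -> m (ltransl s f) = m f
}.

End translation.

Section almost_periodic.
Variables (R : realType) (S : semitopologicalSemigroupType).

Definition Cb : set (linf R S) := [set f | continuous (f : S -> R[i]^o)].

(* Relative compactness in the norm topology of the subspace C(S): the closure
   relative to C(S) is the trace on C(S) of the closure in l^oo(S). *)
Definition AP : set (linf R S) :=
  [set f | Cb f /\ compact (closure (range (fun s : S => ltransl s f)) `&` Cb)].

End almost_periodic.

Section weak.
Variables (F : numFieldType) (E : normedModType F).

Definition topological_dual : Type :=
  {phi : {linear E -> F^o} | continuous (phi : E -> F^o)}.

Definition dual_eval (x : E) : {ptws topological_dual -> F^o} :=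
  fun phi => sval phi x.

(* The coarsest topology (and uniformity) on E making every element of the
   topological dual (uniformly) continuous. *)
Definition weak : Type := initial_topology dual_eval.

HB.instance Definition _ := Uniform.on weak.
HB.instance Definition _ := Pointed.on weak.

End weak.

Section action.
Variables (S : semitopologicalSemigroupType).
Variables (F : numFieldType) (E : normedModType F).
Variables (K : set E) (act : S -> E -> E).

(* An action of S on K; the values of act outside K are irrelevant. *)
Definition is_action : Prop :=
  (forall (s : S) (x : E), K x -> K (act s x)) /\
  (forall (s t : S) (x : E), K x -> act s (act t x) = act (s * t)%g x).

Definition nonexpansive : Prop :=
  forall (s : S) (x y : E), K x -> K y -> `|act s x - act s y| <= `|x - y|.

Definition weakly_separately_continuous : Prop :=
  (forall s : S,
     {within (K : set (weak E)), continuous (act s : weak E -> weak E)}) /\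
  (forall x : E, K x -> continuous (fun s : S => act s x : weak E)).

Definition weakly_equicontinuous : Prop :=
  equicontinuous [set: S]
    (fun s : S => (act s : subspace (K : set (weak E)) -> weak E)).

End action.

Definition fixed_point_property_over (F : numFieldType)
    (S : semitopologicalSemigroupType) : Prop :=
  forall (E : completeNormedModType F) (K : set E) (act : S -> E -> E),
    K !=set0 -> compact (K : set (weak E)) -> convex_set (K : set (convex_lmodType E)) ->
    is_action K act ->
    weakly_separately_continuous K act ->
    weakly_equicontinuous K act ->
    nonexpansive K act ->
    exists2 x : E, K x & forall s : S, act s x = x.

(* Property (E), for real as well as complex Banach spaces. *)
Definition fixed_point_property (R : realType)
    (S : semitopologicalSemigroupType) : Prop :=
  fixed_point_property_over R S /\ fixed_point_property_over R[i] S.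

(* Main.v *)
Require Import Defs.
From HB Require Import structures.
From mathcomp Require Import all_boot all_order all_algebra.
From mathcomp Require Import complex.
From mathcomp Require Import all_classical all_reals all_analysis.
From mathcomp Require Import lra ring.

Set Implicit Arguments.
Unset Strict Implicit.
Unset Printing Implicit Defensive.

Import Order.TTheory GRing.Theory Num.Theory.
Import ComplexField.Normc.
Import numFieldNormedType.Exports.

Local Open Scope classical_set_scope.
Local Open Scope ring_scope.

(** The two directions rest on different compactness arguments.

    From a mean to a fixed point.  Let S act on K as in (E), and replace K by a
    minimal nonempty weakly compact convex invariant subset A
    ([minimal_convex_invariant]).  For a weakly continuous function h on A and a
    point x of A, the function s |-> h (s . x) is almost periodic, because an
    equicontinuous family of self-maps of a compact set is totally bounded for
    uniform closeness.  A left invariant mean on AP(S) therefore yields an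
    invariant probability on A, whose support F satisfies s . F = F for every s
    ([mean_supp_act]).

    On such an F the action is distal: by pigeonhole some power of s is uniformly
    close to the identity of F ([recurrence]).  Consequently each s is isometric
    for the norm on F, as the norm is weakly lower semicontinuous
    ([distal_isometry]), and the weak closure F1 of an orbit in F is minimal
    ([orbit_closure_sym]).  This makes F1 totally bounded in norm
    ([orbit_finite_cover]): an infinite separated subset of an orbit would live
    in the orbit closure of a countable submonoid, which is norm separable; by
    Baire's theorem a small norm ball has weak interior there, and by minimality
    finitely many isometric copies of that ball would cover everything.  DeMarr's
    argument finishes the proof ([common_fixed_point]): if F1 had diameter M > 0,
    then an average u of finitely many of its points would satisfy
    |u - y| <= r < M for all y in F1, and the points of A with that property
    would form a smaller convex invariant set.

    This argument takes place in a uniform space with an abstract metric, the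
    norm distance, of which only the properties in [norming_metric] matter.  They
    follow from the Hahn-Banach theorem, proved here for real functionals on a
    module over any F with an embedding R -> F, so that real and complex Banach
    spaces are treated together.

    From fixed points to a mean.  Given almost periodic f_1, ..., f_n, send a
    mean m on all bounded functions to the family of numbers m (f_i) and
    m (l_s f_i), seen as a bounded function on (S with an identity adjoined) x
    {1, ..., n}.  Almost periodicity makes this map continuous from the pointwise
    topology on means to the supremum norm, so its image is a norm compact convex
    set.  S acts on the image through m |-> m o l_s; the action is nonexpansive,
    and weakly equicontinuous since the weak and norm topologies agree on a norm
    compact set.  A fixed point is a mean invariant on f_1, ..., f_n
    ([finite_invariant_mean]), and compactness of the set of means provides one
    mean that is invariant on all of AP(S). *)

Local Notation Re := (@complex.Re _).
Local Notation Im := (@complex.Im _).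

(** * Compactness and equicontinuity in uniform spaces *)

Lemma continuous_nbhs (T U : topologicalType) (f : T -> U) (t : T) (B : set U) :
  {for t, continuous f} -> nbhs (f t) B -> nbhs t [set x | B (f x)].
Proof. by move=> cf nB; exact: (cf B nB). Qed.

(** A neighbourhood U x is required rather than an open set because the U x used
    below impose a condition only on the points of K. *)
Lemma compact_subcover (X : topologicalType) (K : set X) (U : X -> set X) :
  compact K -> (forall x, K x -> nbhs x (U x)) ->
  exists s : seq X, (forall x, x \in s -> K x) /\
    forall y, K y -> exists2 x, x \in s & U x y.
Proof.
move=> /compact_near_coveringP cK nU.
pose F := filter_from [set s : seq X | forall x, x \in s -> K x]
  (fun s => [set t : seq X | {subset s <= t}]).
have FF : Filter F.
  apply: filter_from_filter; first by exists [::] => //= x; rewrite in_nil.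
  move=> s t sK tK; exists (s ++ t).
    by move=> x; rewrite mem_cat => /orP[/sK|/tK].
  move=> u stu; split=> x xs; apply: stu; rewrite mem_cat xs ?orbT//.
pose P (s : seq X) (y : X) := exists2 x, x \in s & U x y.
have [x Kx|s sK /(_ s)] := cK _ F P FF.
  exists (U x, [set t : seq X | x \in t]) => /=.
    split; first exact: nU.
    exists [:: x]; first by move=> z; rewrite inE => /eqP->.
    by move=> t /(_ x); apply; rewrite mem_head.
  by move=> [y t] /= [Uxy xt]; exists x.
by move=> /(_ (fun _ => id)) h; exists s; split => // y /h.
Qed.

(** The sets of D generate a proper filter on K; its cluster points lie in every
    member of D. *)
Lemma compact_directed (X : topologicalType) (K : set X) (D : set (set X)) :
  compact K -> D !=set0 ->
  (forall A, D A -> [/\ closed A, A `<=` K & A !=set0]) ->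
  (forall A B, D A -> D B -> exists2 C, D C & C `<=` A `&` B) ->
  exists x, forall A, D A -> A x.
Proof.
move=> cK [A0 DA0] DP dir.
have FF : ProperFilter (filter_from D id).
  apply: filter_from_proper; first apply: filter_from_filter.
  - by exists A0.
  - by move=> A B DA DB; have [C DC CAB] := dir _ _ DA DB; exists C.
  - by move=> A /DP[].
have [|x [Kx clx]] := cK _ FF; first by exists A0 => //; have [] := DP _ DA0.
exists x => A DA; have [clA _ _] := DP _ DA; apply: clA => B nB.
by apply: clx nB; exists A.
Qed.

(** Equicontinuity of the restrictions to K: the maps are arbitrary off K. *)
Definition equicontinuous_on (X Y : uniformType) (I : Type) (K : set X)
    (f : I -> X -> Y) :=
  forall x, K x -> forall E, entourage E ->
    nbhs x [set y | K y -> forall i, E (f i x, f i y)].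

Lemma entourage_seqI (X : uniformType) (T : eqType) (V : T -> set (X * X))
    (s : seq T) : (forall x, x \in s -> entourage (V x)) ->
  exists2 W, entourage W & forall x, x \in s -> W `<=` V x.
Proof.
elim: s => [_|a s ih ent]; first by exists setT => //; exact: entourageT.
have [W eW WV] := ih (fun x xs => ent x (@mem_behead _ (a :: s) x xs)).
exists (V a `&` W); first by apply: filterI => //; apply: ent; rewrite mem_head.
by move=> x; rewrite inE => /orP[/eqP->|/WV WVx]; [exact: subIsetl|];
  apply: subset_trans WVx; exact: subIsetr.
Qed.

(** Heine's theorem: pointwise equicontinuity on a compact set is uniform. *)
Lemma equicontinuous_on_unif (X Y : uniformType) (I : Type) (K : set X)
    (f : I -> X -> Y) (E : set (Y * Y)) :
  compact K -> equicontinuous_on K f -> entourage E ->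
  exists2 W, entourage W & forall x y, K x -> K y -> W (x, y) ->
    forall i, E (f i x, f i y).
Proof.
move=> cK ef eE.
pose Q x W := entourage W /\ forall y, K y -> W (x, y) ->
  forall i, split_ent E (f i y, f i x) /\ split_ent E (f i x, f i y).
have /choice[W WP] x : exists W, K x -> Q x W.
  have [Kx|] := pselect (K x); last by exists setT.
  have eE' : entourage (split_ent E `&` (split_ent E)^-1%relation).
    exact/entourage_invI/entourage_split_ent.
  have /nbhsP[W eW WP] := ef x Kx _ eE'.
  exists W => _; split=> // y Ky Wxy i.
  have : xsection W x y by rewrite /xsection/= inE.
  by move=> /WP /(_ Ky i)[].
have [x Kx|s [sK scov]] := @compact_subcover _ K
    (fun x => xsection (split_ent (W x)) x) cK.
  by apply: nbhs_entourage; apply: entourage_split_ent; have [] := WP _ Kx.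
have [V eV VW] : exists2 V, entourage V & forall x, x \in s -> V `<=` split_ent (W x).
  apply: entourage_seqI => x xs; apply: entourage_split_ent.
  by have [] := WP _ (sK _ xs).
exists V => // x y Kx Ky Vxy i.
have [z zs] := scov x Kx; rewrite /xsection/= inE => zx.
have [eW Wz] := WP _ (sK _ zs).
apply: (entourage_split (f i z)) => //.
  have /(Wz x Kx)/(_ i)[]// : W z (z, x) by apply: split_ent_subset zx.
have /(Wz y Ky)/(_ i)[]// : W z (z, y).
apply: (entourage_split x) => //; exact: VW.
Qed.

(** Ascoli's theorem as a finite colouring in which maps of one colour are
    uniformly E-close.  The colour of f i is the function that sends each point of
    a finite net of K to a point, near its image under f i, of a finite net of L. *)
Lemma equicontinuous_on_colour (X Y : uniformType) (I : Type) (K : set X)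
    (L : set Y) (f : I -> X -> Y) (E : set (Y * Y)) :
  compact K -> compact L -> (forall i x, K x -> L (f i x)) ->
  equicontinuous_on K f -> entourage E ->
  exists (T : finType) (c : I -> T), forall i j, c i = c j ->
    forall y, K y -> E (f i y, f j y).
Proof.
move=> cK cL fKL ef eE.
have eE1 := entourage_split_ent eE.
set E1 := split_ent E in eE1; have eE2 := entourage_split_ent eE1.
set E2 := split_ent E1 in eE2.
pose E3 := E2 `&` E2^-1%relation; have eE3 : entourage E3 by exact: entourage_invI.
have [W eW fW] := equicontinuous_on_unif cK ef eE3.
have [x Kx|s [sK scov]] := @compact_subcover _ K (fun x => xsection W x) cK.
  exact: nbhs_entourage.
have [x Kx|t [tL tcov]] := @compact_subcover _ L (fun x => xsection E3 x) cL.
  exact: nbhs_entourage.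
have /choice[g gP] (p : I * 'I_(size s)) : exists b : 'I_(size t),
    E3 (tnth (in_tuple t) b, f p.1 (tnth (in_tuple s) p.2)).
  have Kp : K (tnth (in_tuple s) p.2) by apply: sK; exact: mem_tnth.
  have [z zt] := tcov _ (fKL p.1 _ Kp); rewrite /xsection/= inE => zf.
  have /tnthP[b zb] : z \in in_tuple t by [].
  by exists b; rewrite -zb.
exists {ffun 'I_(size s) -> 'I_(size t)}, (fun i => [ffun a => g (i, a)]).
move=> i j /ffunP cij y Ky.
have [x xs] := scov y Ky; rewrite /xsection/= inE => Wxy.
have /tnthP[a xa] : x \in in_tuple s by [].
have fx k : E3 (f k x, f k y) by apply: fW => //; exact: sK.
have := cij a; rewrite !ffunE => gij.
have := gP (i, a); have := gP (j, a); rewrite /= -gij -xa => -[g1 g2] [h1 h2].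
apply: (entourage_split (tnth (in_tuple t) (g (i, a)))) => //.
  by apply: (entourage_split (f i x)) => //; have [] := fx i.
by apply: (entourage_split (f j x)) => //; have [] := fx j.
Qed.

Lemma nat_pigeonhole (T : finType) (c : nat -> T) :
  exists m n, (m < n)%N /\ c m = c n.
Proof.
apply: contrapT => nex.
have inj : injective (fun k : 'I_(#|T|.+1) => c k).
  move=> a b cab; case: (ltngtP (a : nat) (b : nat)) => [ab|ab|/val_inj//].
    by exfalso; apply: nex; exists a, b.
  by exfalso; apply: nex; exists b, a.
by have := leq_card _ inj; rewrite card_ord ltnn.
Qed.

(** * Distality of surjective equicontinuous actions *)

Section dynamics.
Variables (X : uniformType) (K F : set X) (G : set (X -> X)).
Hypotheses (cK : compact K) (cF : closed F) (FK : F `<=` K).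
Hypotheses (GK : forall g x, G g -> K x -> K (g x)).
Hypothesis Gcomp : forall g h, G g -> G h -> G (g \o h).
Hypothesis Gid : G id.
Hypothesis Geq : equicontinuous_on K (fun g : {g | G g} => sval g).
Hypothesis GF : forall g, G g -> g @` F = F.

Lemma iter_closed g n : G g -> G (iter n g).
Proof. by move=> Gg; elim: n => [|n ih]//=; exact: Gcomp Gg ih. Qed.

(** Approximate inverses.  Two powers g^m and g^n, m < n, are uniformly close by
    pigeonhole; as g^m maps F onto itself, g^(n-m) is close to the identity on F.
    The witness is g^(n-m-1). *)
Lemma recurrence g E : G g -> entourage E ->
  exists h, [/\ G h, h \o g =1 g \o h & forall y, F y -> E (h (g y), y)].
Proof.
move=> Gg eE.
have [i x Kx|T [c cP]] := equicontinuous_on_colour cK cK _ Geq eE.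
  by apply: GK => //; exact: (svalP i).
pose gn n : {g | G g} := exist _ _ (iter_closed n Gg).
have [m [n [mn cmn]]] := nat_pigeonhole (c \o gn).
exists (iter (n - m).-1 g); split; first exact: iter_closed.
  by move=> y; rewrite /= -iterS iterSr.
move=> y; rewrite -(GF (iter_closed m Gg)) => -[z Fz <-].
have := cP _ _ (esym cmn) z (FK Fz); rewrite /= -iterSr prednK ?subn_gt0//.
by rewrite -iterD subnK// ltnW.
Qed.

(** Orbit closures are minimal: if g x is near z and h is an approximate inverse
    of g, then h z is near h (g x), which is near x. *)
Lemma orbit_closure_sym x z :
  F x -> closure [set g x | g in G] z -> closure [set g z | g in G] x.
Proof.
move=> Fx clz.
have OF : [set g x | g in G] `<=` F.
  by move=> _ [g Gg <-]; rewrite -(GF Gg); exists x.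
have Fz : F z by apply: cF; apply: closure_subset clz.
move=> B /nbhsP[E eE EB].
have eE1 := entourage_split_ent eE; have [W eW WP] := equicontinuous_on_unif cK Geq
  (entourage_inv eE1).
have [|_ [[g Gg <-] /=]] := clz (xsection W z).
  exact: nbhs_entourage.
rewrite /xsection/= inE => Wzg.
have [h [Gh _ hP]] := recurrence Gg (entourage_inv eE1).
exists (h z); split; first by exists h.
apply: EB; rewrite /xsection/= inE.
apply: (entourage_split (h (g x))) => //; first exact: hP.
by apply: (WP _ _ _ _ Wzg (exist _ h Gh)); apply: FK => //; rewrite -(GF Gg); exists x.
Qed.

End dynamics.

(** Baire's theorem in a compact set.  If no B i had interior in F, closed
    neighbourhoods of points of F could be chosen one inside the other, the next
    one disjoint from the next B i; their common point would be in no B i. *)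
Lemma compact_baire (X : uniformType) (I : countType) (F : set X)
    (B : I -> set X) :
  compact F -> closed F -> F !=set0 -> (forall i, closed (B i)) ->
  F `<=` \bigcup_i B i ->
  exists i x, F x /\ nbhs x [set y | F y -> B i y].
Proof.
move=> cF clF [x0 Fx0] clB FB; apply: contrapT => nex.
pose state := {p : X * set X | [/\ F p.1, nbhs p.1 p.2 & closed p.2]}.
have step (p : state * nat) : exists q : state, (sval q).2 `<=` (sval p.1).2 /\
    forall i, unpickle p.2 = Some i -> (sval q).2 `&` B i = set0.
  case: p => -[[x N] /= [Fx nN clN]] n; case: (unpickle n) => [i|]; last first.
    by exists (exist _ (x, N) (And3 Fx nN clN)); split=> // ? ?.
  (* N meets F outside B i, else B i would have interior at x *)
  have [y [Fy Ny nBy]] : exists y, [/\ F y, N^° y & ~ B i y].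
    apply: contrapT => nexy; apply: nex; exists i, x; split => //.
    have : nbhs x N^° by apply: open_nbhs_nbhs; split; [exact: open_interior|].
    apply: filterS => y Ny Fy; apply: contrapT => nBy; apply: nexy.
    by exists y.
  have nNB : nbhs y (N `&` ~` B i).
    apply: filterI => //; apply: open_nbhs_nbhs; split=> //.
    exact: closed_openC.
  have [M nM MNB] := @uniform_regular X y _ nNB.
  have clM : nbhs y (closure M) by apply: filterS nM; exact: subset_closure.
  exists (exist _ (y, closure M) (And3 Fy clM (@closed_closure _ M))) => /=.
  split; first by move=> z /MNB[].
  by move=> _ [<-]; rewrite -subset0 => z [/MNB[_ nB] /nB].
have /choice[f fP] := step.
have nT : nbhs x0 setT by exact: filterT.
pose s0 : state := exist _ (x0, setT) (And3 Fx0 nT closedT).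
pose s := fix s n := if n is m.+1 then f (s m, m) else s0.
have sS m n : (m <= n)%N -> (sval (s n)).2 `<=` (sval (s m)).2.
  elim: n => [|n ih]; first by rewrite leqn0 => /eqP->.
  rewrite leq_eqVlt => /orP[/eqP->//|]; rewrite ltnS => /ih.
  by apply: subset_trans; have [] := fP (s n, n).
have [|A [n _ <-]|_ _ [m _ <-] [n _ <-]|x sx] := @compact_directed X F
    [set F `&` (sval (s n)).2 | n in [set: nat]] cF.
- by exists (F `&` (sval (s 0%N)).2), 0%N.
- have [Fs ns cs] := svalP (s n); split; [exact: closedI|exact: subIsetl|].
  by exists (sval (s n)).1; split => //; exact: nbhs_singleton.
- exists (F `&` (sval (s (maxn m n))).2); first by exists (maxn m n).
  move=> y [Fy sy]; split; split=> //.
    by apply: sS sy; exact: leq_maxl.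
  by apply: sS sy; exact: leq_maxr.
have {}sx n : (F `&` (sval (s n)).2) x by apply: sx; exists n.
have [Fx _] := sx 0%N.
have [i _ Bix] := FB _ Fx.
have [_ xs] := sx (pickle i).+1.
have [_ /(_ i (pickleK i))] := fP (s (pickle i), pickle i).
by rewrite -subset0 => /(_ x (conj xs Bix)).
Qed.

(** * Metrics that are suprema of continuous functions *)

(** What the argument retains of the norm distance of a Banach space, the uniform
    space being the Banach space with its weak uniformity.  The norm of x - y is
    attained by a functional of norm at most one (Hahn-Banach), and the weak closure
    of a countable set is norm separable (Mazur). *)
Record norming_metric (R : realType) (X : uniformType) (d : X -> X -> R) := {
  nm_refl : forall x, d x x = 0;
  nm_eq : forall x y, d x y = 0 -> x = y;
  nm_sym : forall x y, d x y = d y x;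
  nm_tri : forall x y z, d x z <= d x y + d y z;
  nm_norming : forall x y, exists phi : X -> R, [/\ continuous phi,
    forall a b, phi a - phi b <= d a b & phi x - phi y = d x y];
  nm_separable : forall (u : nat -> X) (e : R), 0 < e ->
    exists (I : countType) (v : I -> X),
      forall z, closure (range u) z -> exists i, d z (v i) <= e
}.

(** A supremum of continuous functions is lower semicontinuous. *)
Lemma closed_ball_norming (R : realType) (X : uniformType) (d : X -> X -> R)
  (y : X) (r : R) : norming_metric d -> closed [set z | d z y <= r].
Proof.
move=> dP; rewrite -openC openE => z /= /negP; rewrite -ltNge => rz.
have [phi [cphi phile phiE]] := nm_norming dP z y.
have : nbhs (phi z) [set t | r + phi y < t].
  by apply: lt_nbhsr; rewrite -ltrBrDr phiE.
move=> /(cphi z) pz0; have pz : nbhs z [set w | r + phi y < phi w] by exact: pz0.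
suff : nbhs z (~` [set z | d z y <= r]) by [].
apply: filterS pz => t /= pt; apply/negP; rewrite -ltNge.
by apply: lt_le_trans (phile t y); rewrite ltrBrDr.
Qed.

Lemma norming_hausdorff (R : realType) (X : uniformType) (d : X -> X -> R) :
  norming_metric d -> hausdorff_space X.
Proof.
move=> dP x y clxy; apply: (nm_eq dP); apply/eqP; rewrite eq_le.
have d0 : 0 <= d x y.
  by have := nm_tri dP x y x; rewrite (nm_refl dP) (nm_sym dP y); lra.
rewrite d0 andbT leNgt; apply/negP => lt.
have [phi [cphi phile phiE]] := nm_norming dP x y.
have e0 : 0 < d x y / 2 by rewrite divr_gt0.
have nb z : nbhs z [set w | ball (phi z) (d x y / 2) (phi w)].
  by apply: cphi; exact: nbhsx_ballx.
have [z [/=]] := clxy _ _ (nb x) (nb y).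
rewrite /ball/= !ltr_norml => /andP[h1 h2] /andP[h3 h4]; lra.
Qed.

Section metric_dynamics.
Variables (R : realType) (X : uniformType) (d : X -> X -> R).
Hypothesis dP : norming_metric d.
Variables (K F : set X) (G : set (X -> X)).
Hypotheses (cK : compact K) (cF : closed F) (FK : F `<=` K).
Hypotheses (GK : forall g x, G g -> K x -> K (g x)).
Hypothesis Gcomp : forall g h, G g -> G h -> G (g \o h).
Hypothesis Gid : G id.
Hypothesis Geq : equicontinuous_on K (fun g : {g | G g} => sval g).
Hypothesis GF : forall g, G g -> g @` F = F.
Hypothesis Gd : forall g x y, G g -> K x -> K y -> d (g x) (g y) <= d x y.

Lemma image_in g x : G g -> F x -> F (g x).
Proof. by move=> Gg Fx; rewrite -(GF Gg); exists x. Qed.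

(** If g shortened the distance of x and y, so would all the h \o g by at
    least as much, although some h \o g is close to the identity at x and at y; this
    contradicts the lower semicontinuity of d. *)
Lemma distal_isometry g x y : G g -> F x -> F y -> d (g x) (g y) = d x y.
Proof.
move=> Gg Fx Fy; apply/eqP; rewrite eq_le Gd//; try exact: FK.
rewrite leNgt; apply/negP => lt.
have [phi [cphi phile phiE]] := nm_norming dP x y.
pose e := (d x y - d (g x) (g y)) / 3.
have e0 : 0 < e by rewrite divr_gt0// subr_gt0.
have near_phi z : exists2 E, entourage E & forall w, E (z, w) -> `|phi z - phi w| < e.
  have /cphi/nbhsP[E eE EP] : nbhs (phi z) (ball (phi z) e) by exact: nbhsx_ballx.
  by exists E => // w Ezw; have := EP w; apply; rewrite /xsection/= inE.
have [E eE Ex] := near_phi x; have [E' eE' Ey] := near_phi y.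
have [h [Gh _ hP]] := recurrence cK FK GK Gcomp Gid Geq GF Gg
  (entourage_inv (filterI eE eE')).
have /Ex := (hP x Fx).1; have /Ey := (hP y Fy).2.
have := phile (h (g x)) (h (g y)).
have : d (h (g x)) (h (g y)) <= d (g x) (g y).
  by apply: Gd => //; apply: GK => //; exact: FK.
rewrite !ltr_norml => h1 h2 /andP[h3 h4] /andP[h5 h6].
have e3 : 3 * e = d x y - d (g x) (g y) by rewrite /e; field.
by lra.
Qed.

Lemma orbit_closure_stable g x z : G g -> F x ->
  closure [set h x | h in G] z -> closure [set h x | h in G] (g z).
Proof.
move=> Gg Fx clz.
have Fz : F z.
  by apply: cF; apply: closure_subset clz => _ [h Gh <-]; exact: image_in.
move=> B /nbhsP[E eE EB].
have := Geq (FK Fz) eE => /clz[_ [[h Gh <-]] /=] /(_ (FK (image_in Gh Fx)))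
  /(_ (exist _ g Gg))/= gzh.
exists (g (h x)); split; first by exists (g \o h) => //; exact: Gcomp.
by apply: EB; rewrite /xsection/= inE.
Qed.
End metric_dynamics.

Section finite_cover.
Variables (R : realType) (X : uniformType) (d : X -> X -> R).
Hypothesis dP : norming_metric d.
Variables (K F : set X) (G : set (X -> X)).
Hypotheses (cK : compact K) (cF : closed F) (FK : F `<=` K).
Hypotheses (GK : forall g x, G g -> K x -> K (g x)).
Hypothesis Gcomp : forall g h, G g -> G h -> G (g \o h).
Hypothesis Gid : G id.
Hypothesis Geq : equicontinuous_on K (fun g : {g | G g} => sval g).
Hypothesis GF : forall g, G g -> g @` F = F.
Hypothesis Gd : forall g x y, G g -> K x -> K y -> d (g x) (g y) <= d x y.

(** L lists the points already chosen, the next one is taken far from them. *)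
Lemma orbit_separated_seq x e :
  (forall s : seq X, (forall p, p \in s -> [set g x | g in G] p) ->
     exists2 g, G g & forall p, p \in s -> e < d (g x) p) ->
  exists g : nat -> X -> X, (forall n, G (g n)) /\
    forall m n, (m < n)%N -> e < d (g n x) (g m x).
Proof.
move=> ex.
have /choice[f fP] (s : seq X) : exists g,
    (forall p, p \in s -> [set g x | g in G] p) ->
    G g /\ forall p, p \in s -> e < d (g x) p.
  have [sF|nsF] := pselect (forall p, p \in s -> [set g x | g in G] p); last by exists id.
  by have [g Gg gP] := ex s sF; exists g.
pose L := fix L n := if n is m.+1 then f (L m) x :: L m else [::].
have LF n p : p \in L n -> [set g x | g in G] p.
  elim: n p => // n ih p; rewrite /= in_cons => /orP[/eqP->|/ih//].
  by exists (f (L n)) => //; have [] := fP _ ih.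
exists (fun n => f (L n)); split => [n|m n mn]; first by have [] := fP _ (LF n).
have [_] := fP _ (LF n); apply.
elim: n mn => // n ih; rewrite ltnS leq_eqVlt => /orP[/eqP->|/ih].
  exact: mem_head.
by rewrite /= in_cons orbC => ->.
Qed.

(** Otherwise the orbit of x contains infinitely many e-separated points g n x.
    The closure F1 of the orbit of x under the countable monoid G0 generated by
    the g n is separable for d, so one of countably many balls of radius e / 3
    that cover F1 has interior in F1.  By minimality, finitely many preimages of
    this ball by elements of G0 cover F1.  These preimages have diameter at most
    2 e / 3 because G0 acts isometrically, yet by pigeonhole two of the g n x fall
    into the same one. *)
Lemma orbit_finite_cover x e : F x -> 0 < e ->
  exists s : seq X, (forall p, p \in s -> [set g x | g in G] p) /\
    forall z, closure [set g x | g in G] z -> exists2 p, p \in s & d z p <= e.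
Proof.
move=> Fx e0.
suff [s [sF scov]] : exists s : seq X, (forall p, p \in s -> [set g x | g in G] p) /\
    forall g, G g -> exists2 p, p \in s & d (g x) p <= e.
  exists s; split => // z clz.
  have clB : closed (\big[setU/set0]_(p <- s) [set z | d z p <= e]).
    by apply: closed_bigsetU => p _; exact: closed_ball_norming dP.
  have : closure (\big[setU/set0]_(p <- s) [set z | d z p <= e]) z.
    apply: closure_subset clz => _ [g /scov[p ps dp] <-].
    by rewrite -bigcup_seq; exists p.
  by move=> /clB; rewrite -bigcup_seq => -[p ps dp]; exists p.
apply: contrapT => nex.
have [s sF|g [Gg gsep]] := @orbit_separated_seq x e.
  apply: contrapT => nex'; apply: nex; exists s; split => // g Gg.
  apply: contrapT => nexp; apply: nex'; exists g => // p ps.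
  by rewrite ltNge; apply/negP => dp; apply: nexp; exists p.
pose W (w : seq nat) := foldr (fun n k => g n \o k) id w.
pose G0 := [set h | exists w, h = W w].
have G0G : G0 `<=` G by move=> _ [w ->]; elim: w => //= n w ih; exact: Gcomp.
have G0comp h k : G0 h -> G0 k -> G0 (h \o k).
  move=> [w ->] [v ->]; exists (w ++ v); elim: w => //= n w.
  by move=> ih; rewrite -ih.
have G0id : G0 id by exists [::].
have G0K h y : G0 h -> K y -> K (h y) by move=> /G0G; exact: GK.
have G0eq : equicontinuous_on K (fun g : {g | G0 g} => sval g).
  move=> y Ky E eE; apply: filterS (Geq Ky eE) => z yz Kz [h G0h].
  exact: (yz Kz (exist _ h (G0G _ G0h))).
have G0F h : G0 h -> h @` F = F by move=> /G0G; exact: GF.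
(* the G0-orbit of x as a sequence; numbers that encode no word repeat x *)
pose u n := if unpickle n is Some w then W w x else x.
have uE : [set h x | h in G0] = range u.
  apply/seteqP; split => [_ [_ [w ->] <-]|_ [n _ <-]].
    by exists (pickle w) => //; rewrite /u pickleK.
  rewrite /u; case: unpickle => [w|]; first by exists (W w) => //; exists w.
  by exists id.
have e3 : 0 < e / 3 by rewrite divr_gt0.
have [I [v vP]] := nm_separable dP u e3.
set F1 := closure [set h x | h in G0].
have F1F : F1 `<=` F.
  by move=> y clz; apply: cF; apply: closure_subset clz => _ [h /G0G Gh <-];
    exact: image_in GF _ _ Gh Fx.
have clF1 : closed F1 by exact: closed_closure.
have cF1 : compact F1 by apply: subclosed_compact cK _ => // y /F1F/FK.
have F1x : F1 x by apply: subset_closure; exists id.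
have [|||||i [p [F1p nbp]]] := @compact_baire X I F1 (fun i => [set z | d z (v i) <= e / 3]).
- exact: cF1.
- exact: clF1.
- by exists x.
- by move=> i; exact: closed_ball_norming dP.
- by move=> z; rewrite /F1 uE => /vP[i di]; exists i.
have stab := orbit_closure_stable cF FK G0comp G0eq G0F.
(* h z moves a neighbourhood of z into the ball: first back near x, then, by
   k, from x into the interior of the ball *)
have /choice[h hP] z : exists h, F1 z ->
    G0 h /\ nbhs z [set y | F1 y -> d (h y) (v i) <= e / 3].
  have [F1z|] := pselect (F1 z); last by exists id.
  have clx := orbit_closure_sym cK cF FK G0K G0comp G0id G0eq G0F Fx F1z.
  have [_ [[k G0k <-] kx]] := F1p _ (nbhs_interior nbp).
  have /nbhsP[E eE EP] := kx.
  have nx := G0eq x (FK Fx) E eE.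
  have [_ [[l G0l <-] lz]] := clx _ (nbhs_interior nx).
  have /nbhsP[E2 eE2 E2P] := lz.
  exists (k \o l) => _; split; first exact: G0comp.
  apply: filterS (G0eq z (FK (F1F _ F1z)) E2 eE2) => y yz F1y.
  have ly : xsection E2 (l z) (l y).
    by rewrite /xsection/= inE; exact: (yz (FK (F1F _ F1y)) (exist _ l G0l)).
  have F1ly : F1 (l y) := stab _ _ _ G0l Fx F1y.
  have kly : xsection E (k x) (k (l y)).
    rewrite /xsection/= inE.
    exact: (E2P _ ly (FK (F1F _ F1ly)) (exist _ k G0k)).
  exact: EP kly (stab _ _ _ G0k Fx F1ly).
have [z F1z|s [sF1 scov]] := @compact_subcover X F1
    (fun z => [set y | F1 y -> d (h z y) (v i) <= e / 3]) cF1.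
  by have [] := hP z F1z.
have F1g n : F1 (g n x).
  apply: subset_closure; exists (g n) => //; exists [:: n] => //.
have /choice[c cP] (n : nat) : exists a : 'I_(size s),
    d (h (tnth (in_tuple s) a) (g n x)) (v i) <= e / 3.
  have [z zs dz] := scov _ (F1g n); have /tnthP[a za] : z \in in_tuple s by [].
  by exists a; rewrite -za; exact: dz.
have [m [n [mn cmn]]] := nat_pigeonhole c.
have := cP m; have := cP n; rewrite cmn; set z := tnth _ _ => dn dm.
have zs : z \in s by exact: mem_tnth.
have [G0h _] := hP z (sF1 _ zs).
have := gsep m n mn.
rewrite -(distal_isometry dP cK FK GK Gcomp Gid Geq GF Gd (G0G _ G0h));
  [|exact: F1F|exact: F1F].
have := nm_tri dP (h z (g n x)) (v i) (h z (g m x)).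
rewrite (nm_sym dP (v i)); lra.
Qed.
End finite_cover.

(** * Minimal convex invariant sets and DeMarr's argument *)

(** The iterated midpoint of s gives a positive weight to each p in s.  Hence the
    distance from u to a point y that is within M of all the p and within M / 2 of
    one of them is bounded away from M, uniformly in y. *)
Lemma midpoint_center (R : realType) (X : choiceType) (d : X -> X -> R)
    (mid : X -> X -> X) (K : set X) (M : R) (s : seq X) :
  (forall x x' y, d (mid x x') y <= (d x y + d x' y) / 2) ->
  (forall x y, K x -> K y -> K (mid x y)) ->
  0 < M -> s != [::] -> (forall p, p \in s -> K p) ->
  exists u r, [/\ K u, r < M &
    forall y, (forall p, p \in s -> d p y <= M) ->
      d u y <= M /\ ((exists2 p, p \in s & d p y <= M / 2) -> d u y <= r)].
Proof.
move=> dmid Kmid M0; elim: s => // p [|q s] ih _ sK.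
  exists p, (M / 2); split; [by apply: sK; rewrite mem_head|by lra|].
  move=> y dM; split; first by apply: dM; rewrite mem_head.
  by move=> [z]; rewrite inE => /eqP->.
have [|z zs|u [r [Ku rM ur]]] := ih; first by [].
  by apply: sK; rewrite in_cons zs orbT.
have Kp : K p by apply: sK; rewrite mem_head.
exists (mid p u), (Num.max ((M / 2 + M) / 2) ((M + r) / 2)); split.
- exact: Kmid.
- by rewrite gt_max; apply/andP; split; lra.
- move=> y dM; have [|uM ury] := ur y.
    by move=> z zs; apply: dM; rewrite in_cons zs orbT.
  have pM : d p y <= M by apply: dM; rewrite mem_head.
  have := dmid p u y => dpu; split; first by lra.
  move=> [z]; rewrite in_cons => /orP[/eqP->|zs] dz; rewrite le_max.
    by apply/orP; left; lra.
  have /ury : exists2 z, z \in q :: s & d z y <= M / 2 by exists z.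
  by move=> h; apply/orP; right; lra.
Qed.

Section fixed_point.
Variables (R : realType) (X : uniformType) (d : X -> X -> R).
Hypothesis dP : norming_metric d.
Variable mid : X -> X -> X.
Hypothesis dmid : forall x x' y, d (mid x x') y <= (d x y + d x' y) / 2.
Variables (K : set X) (G : set (X -> X)).
Hypotheses (cK : compact K) (K0 : K !=set0).
Hypothesis Kmid : forall x y, K x -> K y -> K (mid x y).
Hypotheses (GK : forall g x, G g -> K x -> K (g x)).
Hypothesis Gcomp : forall g h, G g -> G h -> G (g \o h).
Hypothesis Gid : G id.
Hypothesis Geq : equicontinuous_on K (fun g : {g | G g} => sval g).
Hypothesis Gd : forall g x y, G g -> K x -> K y -> d (g x) (g y) <= d x y.

Let good (A : set X) := [/\ A `<=` K, closed A, A !=set0,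
  (forall g x, G g -> A x -> A (g x)) & (forall x y, A x -> A y -> A (mid x y))].

(** Zorn's lemma for unions, applied to the sets B for which the part of K outside
    B is good. *)
Lemma minimal_convex_invariant : exists A, good A /\
  forall B, good B -> B `<=` A -> A `<=` B.
Proof.
have clK : closed K by apply: compact_closed => //; exact: norming_hausdorff dP.
have [B [gB maxB]] : exists B, good (K `&` ~` B) /\
    forall C, B `<` C -> ~ good (K `&` ~` C).
  apply: (@Zorn_bigcup _ [set B | good (K `&` ~` B)]) => H Hgood Htot.
  have HE x : (K `&` ~` \bigcup_(B in H) B) x <->
      K x /\ forall B, H B -> (K `&` ~` B) x.
    split => [[Kx nB]|[Kx nB]]; split => //.
      by move=> B HB; split => // Bx; apply: nB; exists B.
    by move=> [B HB Bx]; have [_] := nB _ HB.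
  split.
  - exact: subIsetl.
  - have -> : K `&` ~` (\bigcup_(B in H) B) =
        K `&` \bigcap_(B in H) (K `&` ~` B).
      by apply/seteqP; split => x /HE.
    apply: closedI => //; apply: closed_bigI => B HB.
    by have [] := Hgood B HB.
  - have [||A B|x xP] := @compact_directed X K
      [set A | A = K \/ exists2 B, H B & A = K `&` ~` B] cK.
    + by exists K; left.
    + move=> A [->|[B HB ->]]; first by split.
      by have [BK clB B0 _ _] := Hgood B HB; split.
    + move=> [->|[B' HB ->]].
        move=> [->|[C' HC ->]]; first by exists K; [left|].
        by exists (K `&` ~` C'); [right; exists C'|move=> x []].
      move=> [->|[C' HC ->]].
        by exists (K `&` ~` B'); [right; exists B'|move=> x []].
      have [BC|CB] := Htot _ _ HB HC.
        exists (K `&` ~` C'); [by right; exists C'|move=> x [Kx nC]].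
        by split; split => // /BC.
      exists (K `&` ~` B'); [by right; exists B'|move=> x [Kx nC]].
      by split; split => // /CB.
    + exists x; apply/HE; split; first by apply: xP; left.
      by move=> B HB; apply: xP; right; exists B.
  - move=> g x Gg /HE[Kx xH]; apply/HE; split; first exact: GK.
    by move=> B HB; have [_ _ _ + _] := Hgood B HB; apply=> //; exact: xH.
  - move=> x y /HE[Kx xH] /HE[Ky yH]; apply/HE; split; first exact: Kmid.
    by move=> B HB; have [_ _ _ _ +] := Hgood B HB; apply; [exact: xH|exact: yH].
exists (K `&` ~` B); split => // A gA AB; apply: contrapT => nsub.
have AE : K `&` ~` (~` A) = A.
  by rewrite setCK; apply/setIidPr; case: gA.
apply: (maxB (~` A)); last by rewrite AE.
split; last first.
  by move=> AB'; apply: nsub => x [Kx nBx]; apply: contrapT => /AB'.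
by move=> x Bx Ax; have [_] := AB _ Ax.
Qed.

Hypothesis Gsurj : forall A, closed A -> A !=set0 -> A `<=` K ->
  (forall g x, G g -> A x -> A (g x)) ->
  exists F, [/\ closed F, F !=set0, F `<=` A & forall g, G g -> g @` F = F].

(** F1, the closure of an orbit in F, is a singleton.  If its diameter M were
    positive, the set B of the points of A within r < M of all of F1 would be
    nonempty by [midpoint_center], convex and closed; and invariant, because each
    g maps F1 densely into itself and is nonexpansive.  By minimality B is A, which
    contains F1: contradiction. *)
Theorem common_fixed_point : exists2 x, K x & forall g, G g -> g x = x.
Proof.
have [A [[AK clA A0 GA Amid] minA]] := minimal_convex_invariant.
have [F [clF [x Fx] FA GF]] := Gsurj clA A0 AK GA.
have FK : F `<=` K by apply: subset_trans AK.
set F1 := closure [set g x | g in G].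
have GFx g : G g -> F (g x) by move=> Gg; rewrite -(GF _ Gg); exists x.
have F1F : F1 `<=` F.
  by move=> y cly; apply: clF; apply: closure_subset cly => _ [g Gg <-]; exact: GFx.
have F1x : F1 x by apply: subset_closure; exists id.
have stab := orbit_closure_stable clF FK Gcomp Geq GF.
suff F1s y : F1 y -> d x y <= 0.
  have d0 y z : 0 <= d y z.
    by have := nm_tri dP y z y; rewrite (nm_refl dP) (nm_sym dP z); lra.
  exists x; first exact: FK.
  move=> g Gg; apply/esym/(nm_eq dP)/eqP; rewrite eq_le d0 andbT.
  by apply: F1s; exact: stab.
move=> F1y; rewrite leNgt; apply/negP => dxy.
have [s0 [s0F s0cov]] := orbit_finite_cover dP cK clF FK GK Gcomp Gid Geq GF Gd Fx ltr01.
pose D := [set r | exists y z, [/\ F1 y, F1 z & r = d y z]].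
have Dsup : has_sup D.
  split; first by exists (d x y), x, y.
  exists (\sum_(p <- s0) \sum_(q <- s0) `|d p q| + 2) => _ [a [b [F1a F1b ->]]].
  have [p ps dp] := s0cov _ F1a; have [q qs dq] := s0cov _ F1b.
  have h1 := nm_tri dP a p b.
  have h2 := nm_tri dP p q b.
  rewrite (nm_sym dP q b) in h2.
  have h3 : d p q <= \sum_(p <- s0) \sum_(q <- s0) `|d p q|.
    apply: (le_trans (ler_norm _)).
    rewrite (big_rem p)//= (big_rem q)//= -addrA lerDl addr_ge0//.
      exact: sumr_ge0.
    by apply: sumr_ge0 => ? _; exact: sumr_ge0.
  by lra.
pose M := sup D.
have dM a b : F1 a -> F1 b -> d a b <= M.
  by move=> F1a F1b; apply: sup_upper_bound => //; exists a, b.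
have M0 : 0 < M by apply: lt_le_trans dxy (dM _ _ F1x F1y).
have M2 : 0 < M / 2 by rewrite divr_gt0.
have [s [sF scov]] := orbit_finite_cover dP cK clF FK GK Gcomp Gid Geq GF Gd Fx M2.
have sF1 p : p \in s -> F1 p by move=> /sF; exact: subset_closure.
have [|p /sF1/F1F/FA//|u [r [Au rM ur]]] := @midpoint_center R X d mid A M s dmid Amid M0.
  by apply/eqP => s0E; have [p] := scov _ F1x; rewrite s0E.
have {}ur y0 : F1 y0 -> d u y0 <= r.
  move=> F1y0; have [|_ h] := ur y0; first by move=> p /sF1 F1p; exact: dM.
  have [p ps dp] := scov _ F1y0; apply: h; exists p => //.
  by rewrite (nm_sym dP); lra.
pose B := A `&` \bigcap_(y in F1) [set z | d z y <= r].
have gB : good B.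
  split.
  - by move=> z [/AK].
  - apply: closedI => //; apply: closed_bigI => z _.
    exact: closed_ball_norming dP.
  - by exists u; split => // y0 /ur.
  - move=> g z Gg [Az zF1]; split; first exact: GA.
    move=> w F1w /=.
    have clC : closed [set v | d (g z) v <= r].
      rewrite (_ : [set v | _] = [set v | d v (g z) <= r]).
        exact: closed_ball_norming dP.
      by apply/seteqP; split => v /=; rewrite (nm_sym dP).
    apply: (clC w) => N /nbhsP[E eE EN].
    (* w is approximated by h (g w) = g (h w), the image of the point h w of F1 *)
    have [h [Gh hg hP]] := recurrence cK FK GK Gcomp Gid Geq GF Gg
      (entourage_inv eE).
    exists (g (h w)); split.
      have F1hw := stab h x w Gh Fx F1w.
      apply: le_trans (zF1 _ F1hw); apply: Gd => //; first exact: AK.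
      by apply: FK; exact: F1F.
    apply: EN; rewrite /xsection/= inE.
    by have := hP w (F1F _ F1w); have := hg w => /= ->.
  - move=> z w [Az zF1] [Aw wF1]; split; first exact: Amid.
    move=> v F1v /=; have := zF1 v F1v; have := wF1 v F1v; have := dmid z w v.
    by rewrite /=; lra.
have AB : A `<=` B by apply: minA => // z [].
have : M <= r.
  apply: ge_sup; first by exists (d x y), x, y.
  by move=> _ [a [b [F1a F1b ->]]]; have [_] := AB _ (FA _ (F1F _ F1a)); apply.
by rewrite leNgt rM.
Qed.
End fixed_point.
(** * Bounded functions and almost periodic functions *)

Section complex_norm.
Variable R : realType.
Implicit Types z w : R[i].

Lemma normr_normc z : `|z| = (normc z)%:C%C. Proof. by []. Qed.

Lemma Re_le_normc z : `|Re z| <= normc z.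
Proof. by have := normc_ge_Re z; rewrite normr_normc lecR. Qed.

Lemma normc_le_ReIm z : normc z <= `|Re z| + `|Im z|.
Proof.
case: z => x y /=; rewrite -[leRHS]ger0_norm ?addr_ge0// -sqrtr_sqr ler_wsqrtr//.
rewrite sqrrD !real_normK ?num_real// lerD2r lerDl.
by rewrite mulrn_wge0// mulr_ge0.
Qed.

Lemma Im_le_normc z : `|Im z| <= normc z.
Proof.
case: z => x y /=; rewrite -sqrtr_sqr ler_wsqrtr// lerDr sqr_ge0//.
Qed.

Lemma complex_gt0 z : 0 < z -> exists2 e : R, 0 < e & z = e%:C%C.
Proof.
by case: z => x y; rewrite ltcE /= => /andP[/eqP-> x0]; exists x.
Qed.

Lemma normcR (x : R) : normc x%:C%C = `|x|.
Proof. by rewrite /= expr0n addr0 sqrtr_sqr. Qed.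

Lemma normcB_sym z w : normc (z - w) = normc (w - z).
Proof. by rewrite -opprB normcN. Qed.
End complex_norm.

Section linf_complete.
Variables (R : realType) (S : Type).
Implicit Types f g : linf R S.

Lemma linf_normE f : `|f| = (sup_normr f)%:C%C. Proof. by []. Qed.

Lemma linf_ballE f g (e : R) : ball f e%:C%C g = (sup_normr (f - g) < e).
Proof. by rewrite -ball_normE /= linf_normE ltcR. Qed.

Lemma linf_subE f g s : (f - g) s = f s - g s. Proof. by []. Qed.

(** The candidate limit is pointwise, on real and imaginary parts separately so
    that completeness of R suffices. *)
Lemma linf_cauchy_cvg (F : set_system (linf R S)) :
  ProperFilter F -> cauchy F -> cvg F.
Proof.
move=> FF /cauchy_ballP Fc.
have Fe (e : R) : 0 < e -> exists2 f, F [set g | sup_normr (f - g) < e] & True.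
  move=> e0; have /cauchyP/(_ e%:C%C) : cauchy F by apply/cauchy_ballP.
  rewrite ltcR => /(_ e0)[f Ff]; exists f => //; apply: filterS Ff => g.
  by rewrite linf_ballE.
have cvg_part (p : R[i] -> R) (s : S) :
    (forall z w, `|p z - p w| <= normc (z - w)) ->
    exists a : R, (fun f : linf R S => p (f s)) @ F --> a.
  move=> pP; apply/cvg_ex; apply: cauchy_cvg; apply/cauchyP => e e0.
  have [f Ff _] := Fe e e0; exists (p (f s)).
  suff : F [set g | ball (p (f s)) e (p (g s))] by [].
  apply: filterS Ff => g /= fg.
  rewrite -ball_normE /=; apply: le_lt_trans fg; apply: (le_trans (pP _ _)).
  by rewrite -linf_subE normc_le_sup.
have /choice[a aP] s : exists a : R, (fun f : linf R S => Re (f s)) @ F --> a.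
  by apply: cvg_part => z w; rewrite -raddfB Re_le_normc.
have /choice[b bP] s : exists b : R, (fun f : linf R S => Im (f s)) @ F --> b.
  by apply: cvg_part => z w; rewrite -raddfB Im_le_normc.
pose h s : R[i]^o := (a s +i* b s)%C.
have hP (e : R) : 0 < e -> exists2 f, F [set g | sup_normr (f - g) < e] &
    forall s, normc (f s - h s) <= 4 * e.
  move=> e0; have [f Ff _] := Fe e e0; exists f => // s.
  have /cvgrPdist_lt/(_ e e0) aF := aP s.
  have /cvgrPdist_lt/(_ e e0) bF := bP s.
  have [g [[/= fg ag] bg]] := filter_ex (filterI (filterI Ff aF) bF).
  have hg : normc (h s - g s) <= 2 * e.
    apply: (le_trans (normc_le_ReIm _)).
    have -> : Re (h s - g s) = a s - Re (g s) by rewrite raddfB.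
    have -> : Im (h s - g s) = b s - Im (g s) by rewrite raddfB.
    by have := ltW ag; have := ltW bg; lra.
  have fgs : normc (f s - g s) <= e.
    by rewrite -linf_subE; apply: (le_trans (normc_le_sup _ _) (ltW fg)).
  have := le_normcD (f s - g s) (g s - h s); rewrite addrA subrK.
  rewrite (normcB_sym (g s)); lra.
have hlinf : (h : S -> R[i]^o) \in @linf_pred R S.
  have [f _ fP] := hP 1 ltr01; apply/asboolP; exists (4 + sup_normr f) => s.
  have := le_normcD (h s - f s) (f s); rewrite subrK (normcB_sym (h s)).
  by have := fP s; have := normc_le_sup f s; lra.
apply/cvg_ex; exists (Linf hlinf); apply/cvg_ballP => _ /complex_gt0[e e0 ->].
have e6 : 0 < e / 6 by rewrite divr_gt0.
have [f Ff fP] := hP _ e6; apply: filterS Ff => g /= fg.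
rewrite linf_ballE; apply: (@le_lt_trans _ _ (5 * (e / 6))); last by lra.
apply: sup_normr_le => [|s]; first by rewrite mulr_ge0// ltW.
rewrite linf_subE /=.
have fgs : normc (f s - g s) <= e / 6.
  by rewrite -linf_subE; apply: (le_trans (normc_le_sup _ _) (ltW fg)).
have := le_normcD (h s - f s) (f s - g s); rewrite addrA subrK.
rewrite (normcB_sym (h s) (f s)); have := fP s; lra.
Qed.

HB.instance Definition _ := Uniform_isComplete.Build (linf R S) linf_cauchy_cvg.
End linf_complete.

Lemma ultra_seq_cover (T : Type) (I : eqType) (U : set_system T)
    (A : I -> set T) (s : seq I) : UltraFilter U ->
  U [set x | exists2 i, i \in s & A i x] -> exists2 i, i \in s & U (A i).
Proof.
move=> UU; elim: s => [|a s ih] Us.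
  have : ProperFilter U by exact: ultra_proper.
  by move=> PU; have [x []] := filter_ex Us.
have [Ua|Ua] := in_ultra_setVsetC (A a) UU; first by exists a => //; exact: mem_head.
have [|i si Ui] := ih; last by exists i => //; rewrite in_cons si orbT.
apply: filterS (filterI Us Ua) => x [[i is_ Aix] nAa].
by move: is_; rewrite in_cons => /orP[/eqP iE|si]; [rewrite iE in Aix|exists i].
Qed.

Section AP_criterion.
Variables (R : realType) (S : semitopologicalSemigroupType).
Implicit Types f g : linf R S.

Lemma Cb_near f (s : S) (e : R) : Cb f -> 0 < e ->
  \forall t \near s, normc (f s - f t) < e.
Proof.
move=> cf e0; have /cvgrPdist_lt/(_ e%:C%C) := cf s.
by rewrite ltcR => /(_ e0); apply: filterS => t; rewrite normr_normc ltcR.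
Qed.

Lemma Cb_closed : closed (@Cb R S).
Proof.
move=> f clf s; apply/cvgrPdist_lt => _ /complex_gt0[e e0 ->].
have e3 : 0 < e / 3 by rewrite divr_gt0.
have [|g [cg]] := clf (ball f (e / 3)%:C%C).
  by apply: nbhsx_ballx; rewrite ltcR.
rewrite linf_ballE => fg; apply: filterS (Cb_near s cg e3) => t gst.
rewrite normr_normc ltcR.
have fgs := le_lt_trans (normc_le_sup (f - g) s) fg.
have fgt := le_lt_trans (normc_le_sup (f - g) t) fg.
rewrite !linf_subE in fgs fgt.
have := le_normcD (f s - g s) (g s - g t); rewrite addrA subrK => h1.
have := le_normcD (f s - g t) (g t - f t); rewrite addrA subrK => h2.
rewrite (normcB_sym (g t)) in h2; lra.
Qed.

(** A totally bounded orbit in the complete space of bounded functions has a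
    compact closure: an ultrafilter on the closure contains a ball of each finite
    net, hence is Cauchy. *)
Lemma AP_net f : Cb f ->
  (forall e : R, 0 < e -> exists s : seq S, forall t, exists2 t', t' \in s &
     sup_normr (ltransl t' f - ltransl t f) <= e) -> AP f.
Proof.
move=> cf net; split=> //; rewrite compact_ultra => U UU UA.
have PU : ProperFilter U by exact: ultra_proper.
have : cvg U.
  apply: cauchy_cvg; apply/cauchyP => _ /complex_gt0[e e0 ->].
  have e3 : 0 < e / 3 by rewrite divr_gt0.
  have [s sP] := net _ e3.
  have [|t _ Ut] := @ultra_seq_cover _ _ U
      (fun t => ball (ltransl t f) e%:C%C) s UU; last by exists (ltransl t f).
  apply: filterS UA => g [clg _].
  have [|_ [[t _ <-]]] := clg (ball g (e / 3)%:C%C).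
    by apply: nbhsx_ballx; rewrite ltcR.
  have [t' t's tt'] := sP t.
  rewrite linf_ballE => gt; exists t' => //; rewrite linf_ballE.
  apply: (@le_lt_trans _ _ (2 * (e / 3))); last by lra.
  apply: sup_normr_le => [|u]; first by rewrite mulr_ge0// ltW.
  have h1 := le_lt_trans (normc_le_sup (g - ltransl t f) u) gt.
  have h2 := le_trans (normc_le_sup (ltransl t' f - ltransl t f) u) tt'.
  move: h1 h2; rewrite !linf_subE => h1 h2.
  have := le_normcD (ltransl t' f u - ltransl t f u) (ltransl t f u - g u).
  rewrite addrA subrK (normcB_sym (ltransl t f u)) => h3.
  suff : normc (ltransl t' f u - g u) <= 2 * (e / 3) by [].
  by lra.
move=> /cvg_ex[p Up]; exists p; split=> //.
split; last first.
  apply: Cb_closed => N /Up UN.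
  by have [g [[_ cg] Ng]] := filter_ex (filterI UA UN); exists g.
apply: closed_closure => N /Up UN.
by have [g [[clg _] Ng]] := filter_ex (filterI UA UN); exists g.
Qed.

Lemma AP_cst c : AP (linf_cst S c : linf R S).
Proof.
apply: AP_net; first by move=> s; exact: cvg_cst.
move=> e e0; have [[s0 _]|nS] := pselect (exists s : S, True); last first.
  by exists [::] => t; exfalso; apply: nS; exists t.
exists [:: s0] => t; exists s0; first exact: mem_head.
apply: sup_normr_le => [|u]; first exact: ltW.
suff : normc (c - c) <= e by [].
by rewrite subrr normc0 ltW.
Qed.
End AP_criterion.

(** * The invariant probability given by a mean, and its support *)

Section real_continuous_on.
Variables (R : realType) (X : uniformType) (A : set X).
Implicit Types h g : X -> R.

(** Continuity of the restriction of h to A.  Functions such as h \o act s are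
    continuous on A only, even when h is continuous everywhere. *)
Definition cont_on h := forall x, A x -> forall e : R, 0 < e ->
  nbhs x [set y | A y -> `|h x - h y| < e].

Lemma cont_on_continuous h : continuous h -> cont_on h.
Proof.
move=> ch x _ e e0; have /cvgrPdist_lt/(_ e e0) hx := ch x.
by apply: filterS hx => y hy _; exact: hy.
Qed.

Lemma cont_on_lin a h g : cont_on h -> cont_on g ->
  cont_on (fun x => a * h x + g x).
Proof.
move=> ch cg x Ax e e0.
have e1 : 0 < e / (2 * (`|a| + 1)).
  by rewrite divr_gt0// mulr_gt0// ltr_wpDl.
have e2 : 0 < e / 2 by rewrite divr_gt0.
apply: filterS (filterI (ch x Ax _ e1) (cg x Ax _ e2)) => y [hy gy] Ay.
have {}hy := hy Ay; have {}gy := gy Ay.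
rewrite opprD addrACA -mulrBr (le_lt_trans (ler_normD _ _))// normrM.
suff : `|a| * `|h x - h y| <= e / 2 by lra.
rewrite ltr_pdivlMr in hy; last by rewrite mulr_gt0// ltr_wpDl.
have : 0 <= `|h x - h y| by [].
by nra.
Qed.

Lemma cont_on_bounded h : compact A -> cont_on h ->
  exists2 B, 0 < B & forall x, A x -> `|h x| <= B.
Proof.
move=> cA ch.
have [x Ax|s [sA scov]] := @compact_subcover _ A
    (fun x => [set y | A y -> `|h x - h y| < 1]) cA; first exact: ch.
exists (\sum_(x <- s) `|h x| + 1).
  by rewrite ltr_wpDl// sumr_ge0.
move=> y Ay; have [x xs /(_ Ay) hxy] := scov y Ay.
have : `|h x| <= \sum_(x <- s) `|h x|.
  by rewrite (big_rem x)//= lerDl sumr_ge0.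
have := ler_distD 0 (h x) (h y); have := lerB_dist (h y) (h x).
rewrite distrC; lra.
Qed.

Lemma cont_on_unif h (e : R) : compact A -> cont_on h -> 0 < e ->
  exists2 W, entourage W & forall x y, A x -> A y -> W (x, y) ->
    `|h x - h y| < e.
Proof.
move=> cA ch e0.
have [x Ax E eE|W eW WP] := @equicontinuous_on_unif X R unit A (fun _ => h)
    [set xy | ball xy.1 e xy.2] cA _ (entourage_ball _ (PosNum e0)).
  move: eE; rewrite -entourage_ballE => -[d /= d0 dE].
  by apply: filterS (ch x Ax d d0) => y hxy Ay _; apply: dE; exact: hxy.
by exists W => // x y Ax Ay Wxy; have := WP x y Ax Ay Wxy tt.
Qed.
End real_continuous_on.

Section mean_support.
Variables (R : realType) (S : semitopologicalSemigroupType).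
Variables (m : linf R S -> R[i]) (lim : left_invariant_mean (@AP R S) m).
Variables (X : uniformType) (A : set X) (act : S -> X -> X).
Hypotheses (hausX : hausdorff_space X) (cA : compact A).
Hypothesis actA : forall s x, A x -> A (act s x).
Hypothesis actM : forall s t x, A x -> act s (act t x) = act (s * t)%g x.
Hypothesis act_cont : forall x, A x -> continuous (act ^~ x).
Hypothesis act_eq : equicontinuous_on A act.
Variable x0 : X.
Hypothesis Ax0 : A x0.
Implicit Types h g : X -> R.

Let C h := cont_on A h.

(** The default value 0 is used when h is not bounded on the orbit of x0. *)
Definition orbit_fun h : linf R S := insubd 0 (fun s => (h (act s x0))%:C%C).

Lemma orbit_funE h s : C h -> orbit_fun h s = (h (act s x0))%:C%C.
Proof.
move=> Ch; rewrite /orbit_fun val_insubd ifT//.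
have [B _ hB] := cont_on_bounded cA Ch; apply/asboolP; exists B => t.
by rewrite normcR; apply: hB; exact: actA.
Qed.

Lemma cont_on_act h s : C h -> C (h \o act s).
Proof.
move=> Ch x Ax e e0; have /nbhsP[E eE EP] := Ch _ (actA s Ax) e e0.
apply: filterS (act_eq Ax eE) => y /[swap] Ay /(_ Ay s) Exy.
by apply: (EP (act s y)); [rewrite /xsection/= inE|exact: actA].
Qed.

(** Left translates of [orbit_fun h] by s and t are uniformly close as soon as
    act s and act t are uniformly close on A, and up to closeness there are only
    finitely many act s. *)
Lemma orbit_fun_AP h : C h -> AP (orbit_fun h).
Proof.
move=> Ch; apply: AP_net.
  move=> s; apply/cvgrPdist_lt => _ /complex_gt0[e e0 ->].
  have hs : nbhs s [set t | A (act t x0) ->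
      `|h (act s x0) - h (act t x0)| < e].
    exact: (act_cont Ax0 (Ch _ (actA s Ax0) e e0)).
  apply: filterS hs => t /= ht.
  by rewrite !orbit_funE// -rmorphB normr_normc ltcR normcR; apply: ht; exact: actA.
move=> e e0; have [[s0 _]|nS] := pselect (exists s : S, True); last first.
  by exists [::] => t; exfalso; apply: nS; exists t.
have [W eW WP] := cont_on_unif cA Ch e0.
have [T [c cP]] := equicontinuous_on_colour cA cA actA act_eq eW.
have /choice[r rP] k : exists s : S, (exists t, c t = k) -> c s = k.
  by have [[t <-]|nt] := pselect (exists t, c t = k); [exists t|exists s0].
exists [seq r k | k <- enum T] => t; exists (r (c t)).
  by apply: map_f; rewrite mem_enum.
have crt : c (r (c t)) = c t by apply: rP; exists t.
apply: sup_normr_le => [|u]; first exact: ltW.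
suff : normc (orbit_fun h (r (c t) * u)%g - orbit_fun h (t * u)%g) <= e by [].
have Au := actA u Ax0.
rewrite !orbit_funE// -!actM// -rmorphB normcR ltW//.
by apply: WP; [exact: actA|exact: actA|exact: cP crt _ Au].
Qed.

(** The integral of h for the invariant probability that m induces on A. *)
Definition orbit_mean h : R := Re (m (orbit_fun h)).
Local Notation mu := orbit_mean.

Lemma orbit_mean_lin a h g : C h -> C g ->
  mu (fun x => a * h x + g x) = a * mu h + mu g.
Proof.
move=> Ch Cg; rewrite /orbit_mean.
have -> : orbit_fun (fun x => a * h x + g x) =
    a%:C%C *: orbit_fun h + orbit_fun g.
  apply/val_inj/funext => s; rewrite [LHS]orbit_funE; last exact: cont_on_lin.
  have -> : val (a%:C%C *: orbit_fun h + orbit_fun g) s =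
    a%:C%C * orbit_fun h s + orbit_fun g s by [].
  by rewrite !orbit_funE// rmorphD rmorphM.
rewrite (mean_linear lim); try exact: orbit_fun_AP.
by case: (m _) => u v; case: (m _) => u' v' /=; rewrite mul0r subr0.
Qed.

Lemma cont_on_cst (c : R) : C (fun=> c).
Proof. by move=> x _ e e0; apply: filterS filterT => y _ _; rewrite subrr normr0. Qed.

Lemma orbit_mean1 : mu (fun=> 1) = 1.
Proof.
rewrite /orbit_mean (_ : orbit_fun _ = linf_cst S 1) ?(mean_one lim)//.
by apply/val_inj/funext => s; rewrite [LHS]orbit_funE//; exact: cont_on_cst.
Qed.

(** A functional of norm one with m 1 = 1 is positive: if B bounds h, then
    1 - h / B has values in [0, 1], so that its mean is at most 1. *)
Lemma orbit_mean_ge0 h : C h -> (forall x, A x -> 0 <= h x) -> 0 <= mu h.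
Proof.
move=> Ch h0; have [B B0 hB] := cont_on_bounded cA Ch.
have C1 := cont_on_cst 1.
set g := fun x => (- B^-1) * h x + 1.
have Cg : C g by exact: cont_on_lin.
have g01 x : A x -> `|g x| <= 1.
  move=> Ax; have := h0 x Ax; have := hB x Ax; rewrite /g => h1 h2.
  have : 0 <= B^-1 * h x <= 1.
    rewrite mulr_ge0 ?invr_ge0 ?(ltW B0)//= mulrC ler_pdivrMr// mul1r.
    exact: le_trans (ler_norm _) h1.
  by rewrite ler_norml mulNr => /andP[h3 h4]; apply/andP; split; lra.
have : normc (m (orbit_fun g)) <= 1.
  rewrite -lee_fin -(mean_norm lim); apply: ereal_sup_ubound.
  exists (orbit_fun g) => //; split; first exact: orbit_fun_AP.
  rewrite /= linf_normE (_ : 1 = 1%:C%C)// lecR; apply: sup_normr_le => // s.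
  by rewrite orbit_funE// normcR; apply: g01; exact: actA.
have := Re_le_normc (m (orbit_fun g)); rewrite -/(mu g).
rewrite orbit_mean_lin// orbit_mean1 ler_norml => /andP[_ h1] h2.
have : 0 <= B^-1 * mu h by lra.
by rewrite pmulr_rge0// invr_gt0.
Qed.

Lemma orbit_mean_le h g : C h -> C g -> (forall x, A x -> h x <= g x) ->
  mu h <= mu g.
Proof.
move=> Ch Cg hg; have := @orbit_mean_ge0 (fun x => -1 * h x + g x).
rewrite orbit_mean_lin// => h0.
have : 0 <= -1 * mu h + mu g.
  by apply: h0; [exact: cont_on_lin|move=> x /hg; lra].
lra.
Qed.

(** Precomposing h with act s amounts to left translation of [orbit_fun h]. *)
Lemma orbit_mean_act s h : C h -> mu (h \o act s) = mu h.
Proof.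
move=> Ch; rewrite /orbit_mean -(mean_invariant lim s (orbit_fun_AP Ch)).
congr (Re (m _)); apply/val_inj/funext => t.
rewrite [LHS]orbit_funE; last exact: cont_on_act.
by rewrite [RHS](@orbit_funE h (s * t)%g)//= actM.
Qed.

Definition null_fun k := [/\ C k, (forall x, A x -> 0 <= k x) & mu k <= 0].

(** The support of the probability: its complement is the union of the open sets
    where some null function is positive. *)
Definition mean_supp : set X :=
  [set y | A y /\ forall k, null_fun k -> k y <= 0].

Lemma null_fun0 : null_fun (fun=> 0).
Proof.
split=> //; first exact: cont_on_cst.
have := @orbit_mean_lin (-1) (fun=> 1) (fun=> 1) (cont_on_cst 1) (cont_on_cst 1).
rewrite (_ : (fun=> -1 * 1 + 1) = (fun=> 0)); last by apply/funext => x; lra.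
by move=> ->; lra.
Qed.

Lemma null_fun_sum (I : eqType) (k : I -> X -> R) (s : seq I) :
  (forall i, i \in s -> null_fun (k i)) ->
  exists2 K, null_fun K & forall i y, i \in s -> A y -> k i y <= K y.
Proof.
elim: s => [_|a s ih kP].
  by exists (fun=> 0) => //; exact: null_fun0.
have [i is_|K [CK K0 muK] kK] := ih; first by apply: kP; rewrite in_cons is_ orbT.
have [Ca ka0 mua] := kP a (mem_head _ _).
exists (fun x => 1 * k a x + K x).
  split; first exact: cont_on_lin.
  - by move=> x Ax; have := ka0 x Ax; have := K0 x Ax; lra.
  - by rewrite orbit_mean_lin//; lra.
move=> i y; rewrite in_cons => /orP[/eqP->|is_] Ay.
  by have := K0 y Ay; lra.
by have := kK i y is_ Ay; have := ka0 y Ay; lra.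
Qed.

(** The probability is carried by its support.  Near a point of the support h is
    below e, near another point it is below a multiple of a null function that is
    positive there; by compactness h is on all of A below e plus one null
    function. *)
Lemma orbit_mean_vanish h : C h -> (forall x, mean_supp x -> h x <= 0) ->
  mu h <= 0.
Proof.
move=> Ch hsupp; rewrite leNgt; apply/negP => mu0.
set e := mu h / 2; have e0 : 0 < e by rewrite divr_gt0.
have null0 := null_fun0.
have /choice[k kP] y : exists k, A y ->
    null_fun k /\ nbhs y [set z | A z -> h z <= e + k z].
  have [Ay|] := pselect (A y); last by exists (fun=> 0).
  have [suppy|nsupp] := pselect (mean_supp y).
    exists (fun=> 0) => _; split=> //.
    apply: filterS (Ch y Ay e e0) => z hz Az.
    by have := hz Az; have := hsupp y suppy; rewrite ltr_norml => h1 /andP[h2 h3]; lra.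
  have [k [[Ck k0 muk] ky]] : exists k, null_fun k /\ 0 < k y.
    apply: contrapT => nex; apply: nsupp; split=> // k nk; rewrite leNgt.
    by apply/negP => ky; apply: nex; exists k.
  set c := 2 * (`|h y| + 1) / k y.
  have c0 : 0 < c by rewrite divr_gt0// mulr_gt0// ltr_wpDl.
  have ck : c * k y = 2 * (`|h y| + 1) by rewrite /c divfK// gt_eqF.
  have [Cz _ muz] := null0.
  exists (fun x => c * k x + 0) => _; split.
    split; first exact: cont_on_lin.
    - by move=> x Ax; rewrite addr0 mulr_ge0// ?k0// ltW.
    - by rewrite orbit_mean_lin//; nra.
  have ky2 : 0 < k y / 2 by rewrite divr_gt0.
  apply: filterS (filterI (Ch y Ay 1 ltr01) (Ck y Ay _ ky2)) => z [hz kz] Az.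
  have := hz Az; have := kz Az; rewrite !ltr_norml.
  move=> /andP[h1 h2] /andP[h3 h4]; have := ler_norm (h y).
  have : c * (k y / 2) <= c * k z by rewrite ler_pM2l//; lra.
  by rewrite mulrA ck; lra.
have [x Ax|s [sA scov]] := @compact_subcover _ A
    (fun y => [set z | A z -> h z <= e + k y z]) cA; first by case: (kP x Ax).
have [i is_|K [CK K0 muK] kK] := @null_fun_sum _ k s.
  by have [] := kP i (sA _ is_).
have Ce := cont_on_cst 1.
have : mu h <= mu (fun x => e * 1 + K x).
  apply: orbit_mean_le => //; first exact: cont_on_lin.
  move=> x Ax; have [y ys /(_ Ax)] := scov x Ax; have := kK y x ys Ax; lra.
by rewrite orbit_mean_lin// orbit_mean1 /e; lra.
Qed.

Lemma mean_supp_closed : closed mean_supp.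
Proof.
move=> y cly; have clA := compact_closed hausX cA.
have Ay : A y by apply: clA; apply: closure_subset cly => z [].
split=> // k nk; rewrite leNgt; apply/negP => ky.
have [Ck _ _] := nk.
have [z [[Az /(_ k nk) kz] /(_ Az)]] := cly _ (Ck y Ay _ ky).
by rewrite ltr_norml => /andP[h1 h2]; lra.
Qed.

Lemma mean_supp_nonempty : mean_supp !=set0.
Proof.
apply: contrapT => nex.
have := @orbit_mean_vanish (fun=> 1) (cont_on_cst 1).
rewrite orbit_mean1 => h; have : 1 <= 0 :> R; last by lra.
by apply: h => x sx; exfalso; apply: nex; exists x.
Qed.

Lemma null_fun_act s k : null_fun k -> null_fun (k \o act s).
Proof.
move=> [Ck k0 muk]; split; first exact: cont_on_act.
  by move=> x Ax; apply: k0; exact: actA.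
by rewrite orbit_mean_act.
Qed.

(** If y is in the support but not in the compact image of the support, choose
    h >= 0 with h y > 0 that vanishes on this image.  Then h \o act s vanishes on
    the support, hence h, which has the same mean, is a null function, and h y
    must be 0. *)
Lemma mean_supp_act s : act s @` mean_supp = mean_supp.
Proof.
have subA : mean_supp `<=` A by move=> y [].
have cF : compact mean_supp by apply: subclosed_compact mean_supp_closed cA subA.
have cont_s : {within mean_supp, continuous (act s)}.
  apply/subspace_continuousP => x /subA Ax N /nbhsP[E eE EN].
  apply: filterS (act_eq Ax eE) => y yE Fy; apply: EN.
  by rewrite /xsection/= inE; exact: yE (subA _ Fy) s.
have clI := compact_closed hausX (continuous_compact cont_s cF).
apply/seteqP; split => [_ [x [Ax xs] <-]|y [Ay ys]].
  by split; [exact: actA|move=> k /(null_fun_act s) /xs].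
apply: contrapT => ny.
have /(@uniform_separatorP _ R)[f [cf f01 fy fI]] :=
  @point_uniform_separator R _ _ _ clI ny.
have fy0 : f y = 0 by apply: fy; exists y.
pose h x := -1 * f x + 1.
have Ch : C h by apply: cont_on_lin; [exact: cont_on_continuous|exact: cont_on_cst].
have h0 x : 0 <= h x.
  by have := f01 (f x) (ex_intro2 _ _ x I erefl); rewrite /= in_itv/= /h; lra.
suff nh : null_fun h by have := ys h nh; rewrite /h fy0; lra.
split=> //; rewrite -(orbit_mean_act s Ch).
apply: orbit_mean_vanish; first exact: cont_on_act.
move=> x sx; have fx : f (act s x) = 1 by apply: fI; exists (act s x) => //; exists x.
by rewrite /= /h fx; lra.
Qed.
End mean_support.

(** The monoid G consists of the maps that agree on K with the identity or with
    some act s: as act s (act t x) = act (s * t) x is known on K only, the set of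
    the act s themselves is not closed under composition. *)
Theorem lim_fixed_point (R : realType) (S : semitopologicalSemigroupType)
    (m : linf R S -> R[i]) (X : uniformType) (d : X -> X -> R)
    (mid : X -> X -> X) (K : set X) (act : S -> X -> X) :
  left_invariant_mean (@AP R S) m -> norming_metric d ->
  (forall x x' y, d (mid x x') y <= (d x y + d x' y) / 2) ->
  compact K -> K !=set0 -> (forall x y, K x -> K y -> K (mid x y)) ->
  (forall s x, K x -> K (act s x)) ->
  (forall s t x, K x -> act s (act t x) = act (s * t)%g x) ->
  (forall x, K x -> continuous (act ^~ x)) ->
  equicontinuous_on K act ->
  (forall s x y, K x -> K y -> d (act s x) (act s y) <= d x y) ->
  exists2 x, K x & forall s, act s x = x.
Proof.
move=> lim dP dmid cK K0 Kmid actK actM act_cont act_eq act_d.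
pose G := [set g | (forall x, K x -> g x = x) \/
  exists s, forall x, K x -> g x = act s x].
have Gact s : G (act s) by right; exists s.
have GK g x : G g -> K x -> K (g x).
  by move=> [gE|[s gE]] Kx; rewrite gE//; exact: actK.
have Gcomp g h : G g -> G h -> G (g \o h).
  move=> Gg Gh; have hK x := GK h x Gh.
  case: Gg => [gE|[s gE]].
    case: Gh => [hE|[t hE]]; [left => x Kx|right; exists t => x Kx] => /=;
      (rewrite gE; [by rewrite hE|exact: hK]).
  case: Gh => [hE|[t hE]]; right; [exists s => x Kx|exists (s * t)%g => x Kx] => /=;
    (rewrite gE; [by rewrite hE// ?actM|exact: hK]).
have Gid : G id by left.
have Geq : equicontinuous_on K (fun g : {g | G g} => sval g).
  move=> x Kx E eE.
  have /nbhsP[E' eE' EE'] : nbhs x (xsection E x) by exact: nbhs_entourage.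
  apply: filterS (filterI (act_eq x Kx E eE) (nbhs_entourage x eE)).
  move=> y [yE Exy] Ky [g /= [gE|[s gE]]]; rewrite !gE//; last exact: yE.
  by move: Exy; rewrite /xsection/= inE.
have Gd g x y : G g -> K x -> K y -> d (g x) (g y) <= d x y.
  by move=> [gE|[s gE]] Kx Ky; rewrite !gE//; exact: act_d.
have hausX := norming_hausdorff dP.
have [|x Kx xG] := common_fixed_point dP dmid cK K0 Kmid GK Gcomp Gid Geq Gd.
  move=> A clA [x0 Ax0] AK GA.
  have cA : compact A by apply: subclosed_compact cK AK.
  have actA s x : A x -> A (act s x) by exact: GA.
  have actMA s t x : A x -> act s (act t x) = act (s * t)%g x.
    by move=> /AK; exact: actM.
  have contA x : A x -> continuous (act ^~ x) by move=> /AK; exact: act_cont.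
  have eqA : equicontinuous_on A act.
    by move=> x /AK Kx E eE; apply: filterS (act_eq x Kx E eE) => y yE /AK.
  have F0 := mean_supp_nonempty lim cA actA actMA contA eqA Ax0.
  have Fcl := @mean_supp_closed R S m X A act hausX cA x0.
  have Fact := mean_supp_act lim hausX cA actA actMA contA eqA Ax0.
  exists (mean_supp m A act x0); split=> //; first by move=> x [].
  have FK x : mean_supp m A act x0 x -> K x by move=> [/AK].
  move=> g [gE|[s gE]].
    apply/seteqP; split => [_ [x Fx <-]|x Fx]; first by rewrite gE//; exact: FK.
    by exists x => //; apply: gE; exact: FK.
  rewrite -[RHS](Fact s); apply: eq_imagel => x Fx.
  by apply: gE; exact: FK.
by exists x => // s; exact: xG.
Qed.

(** * The Hahn-Banach theorem for real functionals *)

Section hahn_banach.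
Variables (R : realType) (F : nzRingType) (iota : {rmorphism R -> F}).
Variable V : lmodType F.
Implicit Types (p q : V -> R) (x y z : V).
Local Notation "a *! x" := (iota a *: x) (at level 40).

Definition sublinear p := (forall x y, p (x + y) <= p x + p y) /\
  (forall (a : R) x, 0 <= a -> p (a *! x) = a * p x).

Lemma real_scaleA (a b : R) x : a *! (b *! x) = (a * b) *! x.
Proof. by rewrite scalerA rmorphM. Qed.

Lemma sublinear0 p : sublinear p -> p 0 = 0.
Proof. by move=> [_ ph]; have := ph 0 0 (lexx _); rewrite scaler0 mul0r. Qed.

Lemma sublinearN p x : sublinear p -> - p (- x) <= p x.
Proof.
move=> sp; have [pD _] := sp; have := pD x (- x).
by rewrite subrr sublinear0//; lra.
Qed.

(** [slope_inf q z] is the largest sublinear function below q whose value at - z is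
    at most - q z.  A minimal sublinear q coincides with it, whence
    q x + q z <= q (x + z): minimal sublinear functions are additive. *)
Definition slope_set q z x := [set q (x + t *! z) - t * q z | t in [set t | 0 <= t]].
Definition slope_inf q z x := inf (slope_set q z x).

Lemma slope_has_inf q z x : sublinear q -> has_inf (slope_set q z x).
Proof.
move=> sq; have [qD qh] := sq; split; first by exists (q (x + 0 *! z) - 0 * q z), 0 => /=.
exists (- q (- x)) => _ [t t0 <-].
have := qD (x + t *! z) (- x); rewrite addrC addKr qh//; lra.
Qed.

Lemma slope_inf_le q z x t : sublinear q -> 0 <= t ->
  slope_inf q z x <= q (x + t *! z) - t * q z.
Proof.
by move=> sq t0; apply: inf_lbound; [have [] := slope_has_inf z x sq|exists t].
Qed.

Lemma slope_inf_ge q z x c : sublinear q ->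
  (forall t, 0 <= t -> c <= q (x + t *! z) - t * q z) -> c <= slope_inf q z x.
Proof.
move=> sq h; apply: lb_le_inf; first by have [] := slope_has_inf z x sq.
by move=> _ [t /h ct <-].
Qed.

Lemma slope_inf_sublinear q z : sublinear q -> sublinear (slope_inf q z).
Proof.
move=> sq; have [qD qh] := sq; split => [x y|a x a0].
  rewrite -lerBlDr; apply: slope_inf_ge => // t t0.
  rewrite lerBlDr [leRHS]addrC -lerBlDr; apply: slope_inf_ge => // s s0.
  rewrite lerBlDr; apply: (le_trans (slope_inf_le z (x + y) sq (addr_ge0 t0 s0))).
  have := qD (x + t *! z) (y + s *! z).
  by rewrite addrACA -scalerDl -rmorphD; lra.
have scale (b : R) (w : V) : 0 < b -> slope_inf q z (b *! w) <= b * slope_inf q z w.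
  move=> b0; rewrite mulrC -ler_pdivrMr//; apply: slope_inf_ge => // t t0.
  rewrite ler_pdivrMr//; have bt : 0 <= b * t by rewrite mulr_ge0// ltW.
  apply: (le_trans (slope_inf_le z (b *! w) sq bt)).
  by rewrite -real_scaleA -scalerDr (qh _ _ (ltW b0)) le_eqVlt; apply/orP; left; apply/eqP; ring.
have [a00|an0] := eqVneq a 0.
  rewrite a00 rmorph0 scale0r mul0r; apply/eqP; rewrite eq_le.
  have := slope_inf_le z 0 sq (lexx 0); rewrite rmorph0 scale0r addr0 (sublinear0 sq).
  move=> h; apply/andP; split; first by lra.
  by apply: slope_inf_ge => // t t0; rewrite add0r qh//; lra.
have ap : 0 < a by rewrite lt_neqAle eq_sym an0.
apply/eqP; rewrite eq_le scale//= -ler_pdivlMl//.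
rewrite -{1}(scale1r x) -(rmorph1 iota) -(mulVf an0) -real_scaleA scale ?invr_gt0//.
Qed.

Lemma slope_inf_le_self q z x : sublinear q -> slope_inf q z x <= q x.
Proof.
move=> sq; have := slope_inf_le z x sq (lexx 0).
by rewrite rmorph0 scale0r addr0 mul0r subr0.
Qed.

(** Zorn's lemma: a chain of sublinear functions below p has its pointwise infimum
    as a lower bound, finite since q x >= - q (- x) >= - p (- x). *)
Lemma minimal_sublinear p : sublinear p -> exists q, [/\ sublinear q,
  (forall x, q x <= p x) & forall r, sublinear r -> (forall x, r x <= q x) ->
    forall x, q x <= r x].
Proof.
move=> sp; pose T := {q | sublinear q /\ forall x, q x <= p x}.
pose t0 : T := exist _ p (conj sp (fun x => lexx _)).
pose le (s t : T) := `[< forall x, sval t x <= sval s x >].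
have [||A Atot|[q [sq qp]] qmin] := @ZL_preorder T t0 le.
- by move=> t; apply/asboolP.
- by move=> r s t /asboolP h1 /asboolP h2; apply/asboolP => x; exact: le_trans (h2 x) (h1 x).
- have [[a Aa]|nA] := pselect (A !=set0); last first.
    by exists t0 => s As; exfalso; apply: nA; exists s.
  pose V_ x := [set sval q x | q in A].
  have hV x : has_inf (V_ x).
    split; first by exists (sval a x), a.
    exists (- p (- x)) => _ [[q [sq qp]] _ <-] /=.
    by apply: le_trans (sublinearN x sq); rewrite lerN2.
  pose r x := inf (V_ x).
  have rle (q : T) x : A q -> r x <= sval q x.
    by move=> Aq; apply: inf_lbound; [have [] := hV x|exists q].
  have rge x c : (forall q : T, A q -> c <= sval q x) -> c <= r x.
    move=> h; apply: lb_le_inf; first by have [] := hV x.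
    by move=> _ [q /h cq <-].
  have sr : sublinear r.
    split => [x y|b x b0].
      rewrite -lerBlDr; apply: (rge _ _) => q Aq.
      rewrite lerBlDr [leRHS]addrC -lerBlDr; apply: (rge _ _) => q' Aq'; rewrite lerBlDr.
      have [/asboolP qq'|/asboolP qq'] := Atot _ _ Aq Aq'.
        apply: (le_trans (rle q' _ Aq')); have [[qD _] _] := svalP q'.
        by have := qD x y; have := qq' x; lra.
      apply: (le_trans (rle q _ Aq)); have [[qD _] _] := svalP q.
      by have := qD x y; have := qq' y; lra.
    have [b00|bn0] := eqVneq b 0.
      rewrite b00 rmorph0 scale0r mul0r; apply/eqP; rewrite eq_le; apply/andP; split.
        by have := rle a 0 Aa; have [sa _] := svalP a; rewrite (sublinear0 sa).
      by apply: (rge _ _) => q Aq; have [sq _] := svalP q; rewrite (sublinear0 sq).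
    have bp : 0 < b by rewrite lt_neqAle eq_sym bn0.
    apply/eqP; rewrite eq_le; apply/andP; split.
      rewrite mulrC -ler_pdivrMr//; apply: (rge _ _) => q Aq; rewrite ler_pdivrMr//.
      by apply: (le_trans (rle q _ Aq)); have [[_ qh] _] := svalP q; rewrite qh// mulrC.
    apply: (rge _ _) => q Aq; have [[_ qh] _] := svalP q; rewrite qh//.
    by rewrite ler_pM2l//; exact: rle.
  have rp x : r x <= p x.
    by apply: (le_trans (rle a x Aa)); have [_] := svalP a; apply.
  exists (exist _ r (conj sr rp)) => s As; apply/asboolP => x /=; exact: rle.
- exists q; split=> // r sr rq x.
  have rp y : r y <= p y by exact: le_trans (rq y) (qp y).
  have /asboolP := qmin (exist _ r (conj sr rp)) (asboolT rq).
  exact.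
Qed.

Definition real_linear (phi : V -> R) := (forall x y, phi (x + y) = phi x + phi y) /\
  (forall (a : R) x, phi (a *! x) = a * phi x).

(** A minimal sublinear function below [slope_inf p z] is linear, and its value at
    - z is at most - p z. *)
Theorem hahn_banach p z : sublinear p -> exists phi : V -> R,
  [/\ real_linear phi, forall x, phi x <= p x & phi z = p z].
Proof.
move=> sp; have sz := slope_inf_sublinear z sp.
have [q [sq qp qmin]] := minimal_sublinear sz.
have qpp x : q x <= p x by exact: le_trans (qp x) (slope_inf_le_self z x sp).
have qD x y : q (x + y) = q x + q y.
  apply/eqP; rewrite eq_le; have [-> _] := sq; rewrite /=.
  have := qmin _ (slope_inf_sublinear y sq) (slope_inf_le_self y ^~ sq) x.
  have := slope_inf_le y x sq ler01; rewrite rmorph1 scale1r; lra.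
have qN x : q (- x) = - q x.
  by have := qD x (- x); rewrite subrr sublinear0//; lra.
exists q; split=> //.
  split=> // a x; have [a0|a0] := leP 0 a; first by have [_ ->] := sq.
  have [_ qh] := sq; rewrite -[a]opprK rmorphN scaleNr qN qh ?oppr_ge0 ?ltW//.
  by rewrite !mulNr.
apply/eqP; rewrite eq_le qpp/=.
have := qp (- z); have := slope_inf_le z (- z) sp ler01.
rewrite rmorph1 scale1r addNr sublinear0// qN; lra.
Qed.
End hahn_banach.

(** * The norm distance over the weak uniformity *)

(** F stands for R or R[i], embedded reals being the image of iota, and rpart
    retracts F onto R on nonnegative elements.  Only the real structure of E is
    used, through the hypothesis that bounded real functionals are weakly
    continuous. *)
Section weak_norming.
Variables (R : realType) (F : numFieldType) (iota : {rmorphism R -> F}).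
Hypothesis iota_le : forall a b, (iota a <= iota b) = (a <= b).
Variable rpart : F -> R.
Hypothesis rpartK : forall a, 0 <= a -> iota (rpart a) = a.
Variable E : normedModType F.
Hypothesis weak_cont : forall phi : E -> R, real_linear iota phi ->
  (forall x, iota (phi x) <= `|x|) -> continuous (phi : weak E -> R).

Definition real_norm (x : E) : R := rpart `|x|.
Local Notation N := real_norm.

Lemma real_normK x : iota (N x) = `|x|. Proof. exact: rpartK. Qed.

Lemma real_normD x y : N (x + y) <= N x + N y.
Proof. by rewrite -iota_le rmorphD !real_normK ler_normD. Qed.

Lemma real_norm_ge0 x : 0 <= N x.
Proof. by rewrite -iota_le rmorph0 real_normK. Qed.

Lemma iota_inj : injective iota.
Proof. by move=> a b ab; apply/eqP; rewrite eq_le -!iota_le ab lexx. Qed.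

Lemma real_normN x : N (- x) = N x.
Proof. by apply: iota_inj; rewrite !real_normK normrN. Qed.

Lemma real_norm_eq0 x : N x = 0 -> x = 0.
Proof. by move=> x0; apply/eqP; rewrite -normr_eq0 -real_normK x0 rmorph0. Qed.

Lemma real_normZ a x : N (iota a *: x) = `|a| * N x.
Proof.
apply: iota_inj; rewrite rmorphM !real_normK normrZ; congr (_ * _).
have [a0|/ltW a0] := leP 0 a; first by rewrite !ger0_norm// -(rmorph0 iota) iota_le.
by rewrite !ler0_norm ?rmorphN// -(rmorph0 iota) iota_le.
Qed.

Lemma real_norm0 : N 0 = 0.
Proof. by apply: iota_inj; rewrite real_normK normr0 rmorph0. Qed.

Lemma real_norm_sublinear : sublinear iota N.
Proof.
by split=> [x y|a x a0]; [exact: real_normD|rewrite real_normZ ger0_norm].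
Qed.

Lemma weak_cont_le (phi : E -> R) : real_linear iota phi ->
  (forall x, phi x <= N x) -> continuous (phi : weak E -> R).
Proof. by move=> lphi le; apply: weak_cont => // x; rewrite -real_normK iota_le. Qed.

Lemma real_linearB (phi : E -> R) x y : real_linear iota phi ->
  phi (x - y) = phi x - phi y.
Proof.
move=> [pD pZ]; rewrite pD; have := pZ (-1) y.
by rewrite rmorphN rmorph1 scaleN1r mulN1r => ->.
Qed.

Section distance_to_subspace.
Variable W : set E.
Hypotheses (W0 : W 0) (WD : forall x y, W x -> W y -> W (x + y)).
Hypothesis WZ : forall a x, W x -> W (iota a *: x).

Definition dist_to x := inf [set N (x - w) | w in W].

Lemma dist_has_inf x : has_inf [set N (x - w) | w in W].
Proof.
split; first by exists (N (x - 0)), 0.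
by exists 0 => _ [w _ <-]; exact: real_norm_ge0.
Qed.

Lemma dist_to_le x w : W w -> dist_to x <= N (x - w).
Proof. by move=> Ww; apply: inf_lbound; [have [] := dist_has_inf x|exists w]. Qed.

Lemma dist_to_ge x c : (forall w, W w -> c <= N (x - w)) -> c <= dist_to x.
Proof.
move=> h; apply: lb_le_inf; first by have [] := dist_has_inf x.
by move=> _ [w /h cw <-].
Qed.

Lemma dist_to_ge0 x : 0 <= dist_to x.
Proof. by apply: dist_to_ge => w _; exact: real_norm_ge0. Qed.

Lemma dist_to_sublinear : sublinear iota dist_to.
Proof.
split=> [x y|a x a0].
  rewrite -lerBlDr; apply: dist_to_ge => w Ww.
  rewrite lerBlDr [leRHS]addrC -lerBlDr; apply: dist_to_ge => v Wv.
  rewrite lerBlDr; apply: (le_trans (dist_to_le (x + y) (WD Ww Wv))).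
  by have := real_normD (x - w) (y - v); rewrite addrACA -opprD; lra.
have scale (b : R) w : 0 < b -> dist_to (iota b *: w) <= b * dist_to w.
  move=> b0; rewrite mulrC -ler_pdivrMr//; apply: dist_to_ge => v Wv.
  rewrite ler_pdivrMr//; apply: (le_trans (dist_to_le _ (WZ b Wv))).
  by rewrite -scalerBr real_normZ (gtr0_norm b0) mulrC.
have [a00|an0] := eqVneq a 0.
  rewrite a00 rmorph0 scale0r mul0r; apply/eqP; rewrite eq_le dist_to_ge0 andbT.
  by have := dist_to_le 0 W0; rewrite subr0 real_norm0.
have ap : 0 < a by rewrite lt_neqAle eq_sym an0.
apply/eqP; rewrite eq_le scale//= -ler_pdivlMl//.
by rewrite -{1}(scale1r x) -(rmorph1 iota) -(mulVf an0) -(real_scaleA iota) scale ?invr_gt0.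
Qed.

(** A real functional dominated by the distance to W vanishes on W, hence on the
    weak closure of any D included in W.  Choosing it equal to the distance at z
    shows that z is in the norm closure of W (Mazur's theorem for subspaces). *)
Lemma weak_closure_dist (D : set E) z : D `<=` W ->
  closure (D : set (weak E)) z -> dist_to z = 0.
Proof.
move=> DW clz; apply/eqP; rewrite eq_le dist_to_ge0 andbT leNgt; apply/negP => z0.
have [phi [lphi phile phiz]] := hahn_banach z dist_to_sublinear.
have distN x : dist_to x <= N x by have := dist_to_le x W0; rewrite subr0.
have cphi : continuous (phi : weak E -> R).
  by apply: weak_cont_le => // x; exact: le_trans (phile x) (distN x).
have := cphi z [set t | 0 < t]; rewrite phiz => /(_ (lt_nbhsr z0)) nz.
have [x [Dx]] := clz _ nz; rewrite /= ltNge => /negP; apply.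
have Wx := DW _ Dx; apply: (le_trans (phile x)).
by have := dist_to_le x Wx; rewrite subrr real_norm0.
Qed.
End distance_to_subspace.

Definition real_comb (u : nat -> E) (l : seq (nat * R)) : E :=
  foldr (fun c v => iota c.2 *: u c.1 + v) 0 l.

Lemma real_comb_cat u l k : real_comb u (l ++ k) = real_comb u l + real_comb u k.
Proof. by elim: l => [|c l ih] /=; rewrite ?add0r// ih addrA. Qed.

Lemma real_combZ u a l : iota a *: real_comb u l = real_comb u [seq (c.1, a * c.2) | c <- l].
Proof.
elim: l => [|c l ih] /=; first by rewrite scaler0.
by rewrite -ih scalerDr (real_scaleA iota).
Qed.

(** Real combinations are norm limits of rational ones; this is what turns the
    span of a sequence into a separable set. *)
Lemma real_comb_rat u l e : 0 < e -> exists k : seq (nat * rat),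
  N (real_comb u l - real_comb u [seq (c.1, ratr c.2) | c <- k]) <= e.
Proof.
elim: l e => [|[n a] l ih] e e0; first by exists [::]; rewrite subrr real_norm0 ltW.
have e2 : 0 < e / 2 by rewrite divr_gt0.
have [k kP] := ih _ e2.
have d0 : 0 < e / 2 / (N (u n) + 1) by rewrite divr_gt0// ltr_wpDl// real_norm_ge0.
have [q] := @rat_in_itvoo R (a - e / 2 / (N (u n) + 1)) a ltac:(by rewrite ltrBlDr ltrDl).
rewrite in_itv/= => /andP[q1 q2].
exists ((n, q) :: k) => /=.
rewrite opprD addrACA -scalerBl -rmorphB.
apply: (le_trans (real_normD _ _)); rewrite real_normZ.
have aq : `|a - ratr q| <= e / 2 / (N (u n) + 1) by rewrite ger0_norm; lra.
suff : `|a - ratr q| * N (u n) <= e / 2 by lra.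
apply: (@le_trans _ _ (e / 2 / (N (u n) + 1) * N (u n))).
  by rewrite ler_wpM2r// real_norm_ge0.
rewrite -mulrA ger_pMr// mulrC ler_pdivrMr ?ltr_wpDl ?real_norm_ge0//.
by rewrite mul1r lerDl.
Qed.

Definition weak_dist (x y : weak E) : R := N ((x : E) - (y : E)).
Definition weak_mid (x y : weak E) : weak E := iota 2^-1 *: ((x : E) + (y : E)).

Lemma weak_mid_dist x x' y :
  weak_dist (weak_mid x x') y <= (weak_dist x y + weak_dist x' y) / 2.
Proof.
rewrite /weak_dist /weak_mid.
have -> : iota 2^-1 *: ((x : E) + x') - y =
    iota 2^-1 *: (((x : E) - y) + ((x' : E) - y)).
  rewrite addrACA [RHS]scalerDr; congr (_ + _).
  rewrite -opprD scalerN; congr (- _).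
  rewrite -[y in y + _]scale1r -[y in _ + y]scale1r -scalerDl -(rmorph1 iota).
  by rewrite -rmorphD (real_scaleA iota) (_ : 2^-1 * (1 + 1) = 1) ?rmorph1 ?scale1r//; field.
rewrite real_normZ ger0_norm ?invr_ge0// mulrC ler_pM2r ?invr_gt0//.
exact: real_normD.
Qed.

Lemma weak_norming : norming_metric weak_dist.
Proof.
split.
- by move=> x; rewrite /weak_dist subrr real_norm0.
- by move=> x y /real_norm_eq0/eqP; rewrite subr_eq0 => /eqP.
- by move=> x y; rewrite /weak_dist -real_normN opprB.
- move=> x y z; rewrite /weak_dist.
  by have := real_normD ((x : E) - y) ((y : E) - z); rewrite addrA subrK.
- move=> x y; have [phi [lphi phile phiE]] := hahn_banach ((x : E) - y) real_norm_sublinear.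
  exists phi; split; first exact: weak_cont_le.
    by move=> a b; rewrite -(real_linearB _ _ lphi).
  by rewrite -(real_linearB _ _ lphi).
move=> u e e0; pose W := range (real_comb (u : nat -> E)).
exists (seq (nat * rat) : countType), (fun k => real_comb u [seq (c.1, ratr c.2) | c <- k]).
move=> z clz.
have W0 : W 0 by exists [::].
have WD x y : W x -> W y -> W (x + y).
  by move=> [l _ <-] [k _ <-]; exists (l ++ k) => //; rewrite real_comb_cat.
have WZ a x : W x -> W (iota a *: x).
  by move=> [l _ <-]; exists [seq (c.1, a * c.2) | c <- l] => //; rewrite real_combZ.
have uW : range u `<=` W.
  move=> _ [n _ <-]; exists [:: (n, 1)] => //=.
  by rewrite rmorph1 scale1r addr0.
have dz := weak_closure_dist W0 WD WZ uW clz.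
have e2 : 0 < e / 2 by rewrite divr_gt0.
have [_ [_ [l _ <-] <-]] := inf_adherent e2 (dist_has_inf W0 z).
rewrite -/(dist_to W z) dz add0r => zl.
have [k kP] := real_comb_rat u l e2; exists k.
rewrite /weak_dist; have := real_normD (z - real_comb u l)
  (real_comb u l - real_comb u [seq (c.1, ratr c.2) | c <- k]).
rewrite addrA subrK; lra.
Qed.
End weak_norming.

(** These two facts characterise the topology of pointwise convergence for an
    index type I without decidable equality, such as the topological dual. *)
Lemma ptws_eval_continuous (I : Type) (V : topologicalType) (i : I) :
  continuous (fun g : {ptws I -> V} => g i).
Proof.
move=> g; have /cvg_sup/(_ i) h : g --> g by apply: cvg_id.
move=> A nA; apply: h.
exact: (@initial_continuous _ _ (fun g : I -> V => g i) g A nA).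
Qed.

Lemma ptws_cvg (I : Type) (V : topologicalType) (F : set_system {ptws I -> V})
    (f : {ptws I -> V}) : Filter F ->
  (forall i, (fun g : {ptws I -> V} => g i) @ F --> f i) -> F --> f.
Proof.
move=> FF h; apply/cvg_sup => i A [_ [[B oB <-] Bfi] BA].
have hB : F [set g | B (g i)] := h i B (open_nbhs_nbhs (conj oB Bfi)).
by apply: filterS hB => g /BA.
Qed.

Lemma dual_eval_continuous (F : numFieldType) (E : normedModType F)
    (t : topological_dual E) : continuous (fun x : weak E => sval t x : F^o).
Proof.
move=> x; apply: (@continuous_comp (weak E) {ptws topological_dual E -> F^o}
  F^o (@dual_eval F E) (fun g => g t)).
  exact: (@initial_continuous E {ptws topological_dual E -> F^o}).
exact: ptws_eval_continuous.
Qed.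

Lemma to_weak_continuous (F : numFieldType) (E : normedModType F) :
  continuous (fun x : E => x : weak E).
Proof.
apply: (@continuous_comp_initial E E {ptws topological_dual E -> F^o} (@dual_eval F E)).
move=> x; apply: ptws_cvg => t.
exact: (svalP t x).
Qed.

Lemma weak_cont_real (R : realType) (E : normedModType R) (phi : E -> R) :
  real_linear (idfun : {rmorphism R -> R}) phi ->
  (forall x, phi x <= `|x|) -> continuous (phi : weak E -> R).
Proof.
move=> [pD pZ] pN.
have lphi : linear (phi : E -> R^o) by move=> a x y; rewrite pD pZ.
pose L := GRing.isLinear.Build R E R^o *:%R phi lphi.
pose Phi : {linear E -> R^o} := HB.pack phi L.
have pN' x : `|phi x| <= `|x|.
  rewrite ler_norml pN andbT lerNl; have := pN (- x).
  by rewrite normrN -scaleN1r (pZ (-1)) mulN1r.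
have cPhi : continuous (Phi : E -> R^o).
  move=> x; apply/cvgrPdist_lt => e e0; near=> y.
  rewrite -linearB; apply: (le_lt_trans (pN' _)).
  by near: y; apply: cvgr_dist_lt.
move=> x; exact: (@dual_eval_continuous R E (exist _ Phi cPhi) x).
Unshelve. all: end_near. Qed.

Lemma Re_continuous (R : realType) : continuous (Re : R[i]^o -> R).
Proof.
move=> z; apply/(@cvgrPdist_lt _ _ _ _ (nbhs_filter (z : R[i]^o))) => e e0.
have e0' : 0 < e%:C%C by rewrite ltcR.
apply: (@filterS _ _ (nbhs_filter (z : R[i]^o))) (nbhsx_ballx (z : R[i]^o) _ e0') => w.
rewrite -ball_normE /= normr_normc ltcR.
by apply: le_lt_trans; rewrite -raddfB Re_le_normc.
Qed.

(** phi is the real part of the complex linear functional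
    x |-> phi x - i phi (i x), and this functional is norm continuous. *)
Lemma weak_cont_complex (R : realType) (E : normedModType R[i]) (phi : E -> R) :
  real_linear (real_complex R : {rmorphism R -> R[i]}) phi ->
  (forall x, (phi x)%:C%C <= `|x|) -> continuous (phi : weak E -> R).
Proof.
move=> [pD pZ] pN.
pose psi (x : E) : R[i]^o := (phi x +i* - phi ('i%C *: x))%C.
have ii (x : E) : 'i%C *: ('i%C *: x) = - x by rewrite scalerA -expr2 sqr_i scaleN1r.
have pNeg x : phi (- x) = - phi x.
  by have := pZ (-1) x; rewrite rmorphN rmorph1 scaleN1r mulN1r.
have pC (a : R[i]) x : phi (a *: x) = Re a * phi x + Im a * phi ('i%C *: x).
  rewrite {1}(complexE a) scalerDl pD pZ; congr (_ + _).
  by rewrite mulrC -scalerA pZ.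
have iZ (a : R[i]) x : 'i%C *: (a *: x) = a *: ('i%C *: x).
  by rewrite !scalerA mulrC.
have lpsi : linear psi.
  move=> a x y.
  have e1 : phi (a *: x + y) = Re a * phi x + Im a * phi ('i%C *: x) + phi y.
    by rewrite pD pC.
  have e2 : phi ('i%C *: (a *: x + y)) =
      Re a * phi ('i%C *: x) - Im a * phi x + phi ('i%C *: y).
    by rewrite scalerDr pD iZ pC ii pNeg mulrN.
  rewrite /psi e1 e2 {e1 e2}.
  case: a => a b; apply/eqP; rewrite eq_complex.
  by apply/andP; split; apply/eqP => /=; ring.
pose L := GRing.isLinear.Build R[i] E R[i]^o *:%R psi lpsi.
pose Psi : {linear E -> R[i]^o} := HB.pack psi L.
have pN' x (e : R) : `|x| < e%:C%C -> `|phi x| < e.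
  move=> xe; rewrite ltr_norml ltrNl -pNeg -!ltcR.
  by rewrite !(le_lt_trans (pN _))// normrN.
have cPsi : continuous (Psi : E -> R[i]^o).
  move=> x; apply/cvgrPdist_lt => _ /complex_gt0[e e0 ->].
  have e2 : 0 < (e / 2)%:C%C by rewrite ltcR divr_gt0.
  near=> y; rewrite -linearB normr_normc ltcR.
  apply: (le_lt_trans (normc_le_ReIm _)) => /=.
  have xy : `|x - y| < (e / 2)%:C%C by near: y; apply: cvgr_dist_lt.
  have h1 := pN' _ _ xy; rewrite normrN.
  have : `|phi ('i%C *: (x - y))| < e / 2.
    apply: pN'; rewrite normrZ normr_normc /=.
    by rewrite expr0n expr1n add0r sqrtr1 mul1r.
  by lra.
move=> x; apply: (@continuous_comp (weak E) R[i]^o R psi Re x).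
  exact: (@dual_eval_continuous _ E (exist _ Psi cPsi) x).
exact: Re_continuous.
Unshelve. all: end_near. Qed.

Lemma fixed_point_property_over_of_lim (R : realType) (F : numFieldType)
    (iota : {rmorphism R -> F}) (rpart : F -> R)
    (S : semitopologicalSemigroupType) (m : linf R S -> R[i]) :
  (forall a b, (iota a <= iota b) = (a <= b)) ->
  (forall a, 0 <= a -> iota (rpart a) = a) ->
  (forall (E : normedModType F) (phi : E -> R), real_linear iota phi ->
    (forall x, iota (phi x) <= `|x|) -> continuous (phi : weak E -> R)) ->
  left_invariant_mean (@AP R S) m -> fixed_point_property_over F S.
Proof.
move=> iota_le rpartK wcont lim E K act K0 cK convK [actK actM] [wsc1 wsc2] weq nexp.
apply: (@lim_fixed_point R S m (weak E) (@weak_dist R F rpart E)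
  (@weak_mid R F iota E) K act lim) => //.
- exact: (weak_norming iota_le rpartK (wcont E)).
- exact: (weak_mid_dist iota_le rpartK).
- move=> x y Kx Ky.
  have h0 : 0 <= 2^-1 :> F by rewrite invr_ge0.
  have h1 : 2^-1 <= 1 :> F by rewrite invf_le1// ler1n.
  have := convK x y (Itv01 h0 h1) (mem_set Kx) (mem_set Ky); rewrite inE.
  rewrite /conv/= /unstable.onem.
  have -> : 1 - 2^-1 = 2^-1 :> F by field.
  by rewrite /weak_mid fmorphV rmorph_nat scalerDr.
- move=> x Kx D eD; have h : within (K : set (weak E)) (nbhs (x : weak E))
      [set y | forall s, [set: S] s -> D (act s x, act s y)].
    by rewrite (nbhs_subspace_in Kx); exact: weq.
  have {}h : nbhs (x : weak E)
      [set y | K y -> forall s, [set: S] s -> D (act s x, act s y)] := h.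
  by apply: filterS h => y yD Ky s; exact: yD Ky s I.
- move=> s x y Kx Ky.
  rewrite -iota_le !rpartK//; exact: nexp.
Qed.

Theorem fixed_point_property_of_lim (R : realType)
    (S : semitopologicalSemigroupType) (m : linf R S -> R[i]) :
  left_invariant_mean (@AP R S) m -> fixed_point_property R S.
Proof.
move=> lim; split.
  apply: (@fixed_point_property_over_of_lim R R idfun id S m) => //.
  exact: weak_cont_real.
apply: (@fixed_point_property_over_of_lim R R[i] (real_complex R) (@complex.Re R) S m) => //.
- by move=> a b; rewrite lecR.
- by move=> a a0; apply: RRe_real; exact: ger0_real.
- exact: weak_cont_complex.
Qed.

(** * The compact convex set of means *)

Section means.
Variables (R : realType) (S : semitopologicalSemigroupType).

Local Notation functionals := {ptws linf R S -> R[i]^o}.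

(** Means on all bounded functions rather than on AP(S), so that a pointwise limit
    of means is again a mean and every left translate of an argument is allowed. *)
Definition is_mean (m : linf R S -> R[i]) :=
  [/\ forall (a : R[i]) f g, m (a *: f + g) = a * m f + m g,
      forall f, normc (m f) <= sup_normr f & m (linf_cst S 1) = 1].

Definition means : set functionals := [set m | is_mean m].

Lemma functional_nbhs (m : functionals) (f : linf R S) (e : R) : 0 < e ->
  nbhs m [set m' : functionals | normc (m f - m' f) < e].
Proof.
move=> e0; have e0' : 0 < e%:C%C by rewrite ltcR.
have nb := nbhsx_ballx (m f : R[i]^o) _ e0'.
have h : nbhs m [set m' : functionals | ball (m f : R[i]^o) e%:C%C (m' f)].
  exact: (continuous_nbhs (@ptws_eval_continuous (linf R S) R[i]^o f m) nb).
have -> : [set m' : functionals | normc (m f - m' f) < e] =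
    [set m' : functionals | ball (m f : R[i]^o) e%:C%C (m' f)].
  by apply/seteqP; split => m'; rewrite /= -ball_normE /= normr_normc ltcR.
exact: h.
Qed.

Lemma small_eq0 (z : R[i]) : (forall e : R, 0 < e -> normc z <= e) -> z = 0.
Proof.
move=> h; apply: eq0_normc; apply/eqP; rewrite eq_le normc_ge0 andbT leNgt.
apply/negP => z0; have := h (normc z / 2); rewrite divr_gt0// => /(_ isT); lra.
Qed.

Lemma means_closed : closed means.
Proof.
move=> m clm; split.
- move=> a f g; apply/eqP; rewrite -subr_eq0; apply/eqP; apply: small_eq0 => e e0.
  have na : 0 < normc a + 2 by rewrite ltr_wpDl ?normc_ge0.
  have d0 : 0 < e / (normc a + 2) by rewrite divr_gt0.
  have [m' [[mlin _ _] [[/= h1 h2] h3]]] := clm _ (filterI (filterI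
    (functional_nbhs m (a *: f + g) d0) (functional_nbhs m f d0))
    (functional_nbhs m g d0)).
  set d := e / _ in d0 h1 h2 h3.
  have -> : m (a *: f + g) - (a * m f + m g) =
    (m (a *: f + g) - m' (a *: f + g)) + (- a * (m f - m' f) + - (m g - m' g)).
    by rewrite mlin; ring.
  apply: (le_trans (le_normcD _ _)).
  have := le_normcD (- a * (m f - m' f)) (- (m g - m' g)).
  rewrite !normcN normcM normcN.
  have : normc a * normc (m f - m' f) <= normc a * d.
    by rewrite ler_wpM2l ?normc_ge0// ltW.
  have : d * (normc a + 2) = e by rewrite /d divfK// gt_eqF.
  by lra.
- move=> f; apply/ler_addgt0Pr => e e0.
  have [m' [[_ mle _] /= h1]] := clm _ (functional_nbhs m f e0).
  have := le_normcD (m f - m' f) (m' f); rewrite subrK.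
  have := mle f; lra.
- apply/eqP; rewrite -subr_eq0; apply/eqP; apply: small_eq0 => e e0.
  have [m' [[_ _ m1] /= h1]] := clm _ (functional_nbhs m (linf_cst S 1) e0).
  by move: h1; rewrite m1 => /ltW.
Qed.

Lemma disc_compact (r : R) : compact [set z : R[i]^o | normc z <= r].
Proof.
pose g (p : R * R) : R[i]^o := (p.1 +i* p.2)%C.
have cg : continuous g.
  move=> p; apply/cvgrPdist_lt => _ /complex_gt0[e e0 ->].
  have e2 : 0 < e / 2 by rewrite divr_gt0.
  have b (z : R) : nbhs z [set x | `|z - x| < e / 2].
    by have := nbhsx_ballx z _ e2; rewrite -ball_normE.
  have h1 : nbhs p [set q : R * R | `|p.1 - q.1| < e / 2].
    exact: (@cvg_fst _ _ (nbhs p.1) (nbhs p.2) _ _ (b p.1)).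
  have h2 : nbhs p [set q : R * R | `|p.2 - q.2| < e / 2].
    exact: (@cvg_snd _ _ (nbhs p.1) (nbhs p.2) _ _ (b p.2)).
  apply: filterS (filterI h1 h2) => q [/= q1 q2]; rewrite normr_normc ltcR.
  apply: (le_lt_trans (normc_le_ReIm _)).
  suff : `|p.1 - q.1| + `|p.2 - q.2| < e by [].
  by lra.
have cc : compact (g @` (`[- r, r]%classic `*` `[- r, r]%classic)).
  apply: continuous_compact; first exact: continuous_subspaceT.
  by apply: compact_setX; exact: segment_compact.
apply: (subclosed_compact _ cc).
  move=> z clz; apply/ler_addgt0Pr => e e0; have e0' : 0 < e%:C%C by rewrite ltcR.
  have [w [/= wr]] := clz _ (nbhsx_ballx (z : R[i]^o) _ e0').
  rewrite -ball_normE /= normr_normc ltcR.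
  by have := le_normcD (z - w) w; rewrite subrK; lra.
move=> z /= zr; exists (Re z, Im z); last by case: z {zr}.
split; rewrite /= in_itv/= -ler_norml.
  exact: le_trans (Re_le_normc z) zr.
exact: le_trans (Im_le_normc z) zr.
Qed.

(** Banach-Alaoglu: the means form a closed subset of a product of discs. *)
Lemma means_compact : compact means.
Proof.
apply: (@subclosed_compact _ means [set m | forall f, normc (m f) <= sup_normr f]).
- exact: means_closed.
- apply: (@tychonoff (linf R S) (fun=> R[i]^o)
    (fun f => [set z | normc z <= sup_normr f])) => f.
  exact: disc_compact.
- by move=> m [].
Qed.

Lemma eval_mean (s : S) : is_mean (fun f : linf R S => f s).
Proof. by split => // f; exact: normc_le_sup. Qed.

Lemma ltransl_mean (s : S) m : is_mean m -> is_mean (m \o ltransl s).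
Proof.
move=> [mD mle m1]; split.
- move=> a f g; rewrite /= -mD; congr m; exact/val_inj/funext.
- move=> f; apply: (le_trans (mle _)); apply: sup_normr_le; first exact: sup_normr_ge0.
  by move=> t; exact: (normc_le_sup f (s * t)%g).
- by rewrite -m1 /=; congr m; exact/val_inj/funext.
Qed.
End means.

(** * Norm compact sets of bounded functions *)

Section pointwise_compact.
Variables (R : realType) (J : Type).

(** On a norm compact set C the norm topology is that of pointwise convergence:
    each y in C away from x is told apart from x by one evaluation, with a margin
    that is valid in a neighbourhood of y.  The list membership is that of plain
    lists as J has no decidable equality. *)
Lemma compact_linf_pointwise (C : set (linf R J)) (x : linf R J) (e : R) :
  compact C -> 0 < e ->
  exists (js : seq (J * R)), (forall p, List.In p js -> 0 < p.2) /\
    forall y, C y -> (forall p, List.In p js -> normc (x p.1 - y p.1) < p.2) ->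
      sup_normr (x - y) < e.
Proof.
move=> cC e0.
have /choice[g gP] (y : linf R J) : exists p : option (J * R),
    if p is Some p then 0 < p.2 /\
      nbhs y [set z | p.2 <= normc (x p.1 - z p.1)]
    else nbhs y [set z | sup_normr (x - z) < e].
  have [->|/eqP xy] := eqVneq y x.
    exists None; have e0' : 0 < e%:C%C by rewrite ltcR.
    by apply: filterS (nbhsx_ballx x _ e0') => z; rewrite linf_ballE.
  have [j xyj] : exists j, x j <> y j.
    apply: contrapT => nex; apply: xy; apply/val_inj/funext => j.
    by apply: contrapT => yxj; apply: nex; exists j => /esym.
  pose d := normc (x j - y j) / 2.
  have d0 : 0 < d.
    rewrite divr_gt0// lt_neqAle normc_ge0 andbT eq_sym; apply/eqP => /eq0_normc.
    by move=> /eqP; rewrite subr_eq0 => /eqP.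
  exists (Some (j, d)); split=> //=.
  have d0' : 0 < d%:C%C by rewrite ltcR.
  apply: filterS (nbhsx_ballx y _ d0') => z; rewrite linf_ballE /= => yz.
  have := le_lt_trans (normc_le_sup (y - z) j) yz; rewrite linf_subE => yzj.
  have := le_normcD (x j - z j) (z j - y j); rewrite addrA subrK.
  have dE : normc (x j - y j) = 2 * d by rewrite /d; field.
  by rewrite (normcB_sym (z j) (y j)); lra.
have [y Cy|s [sC scov]] := @compact_subcover _ C
  (fun y => [set z : linf R J | if g y is Some p then p.2 <= normc (x p.1 - z p.1)
     else sup_normr (x - z) < e]) cC.
  by have := gP y; case: (g y) => [p []|].
exists (pmap g s); split.
  elim: s {sC scov} => //= y s ih p; have := gP y; case: (g y) => [q [q0 _]|_] //=.
    by case=> [<-//|]; exact: ih.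
  exact: ih.
move=> z Cz hz; have [y ys /=] := scov z Cz.
case E : (g y) => [p|//]; rewrite leNgt => /negP[]; apply: hz.
elim: s ys {sC scov} => // w s ih; rewrite inE => /orP[/eqP<-|/ih h] /=.
  by rewrite E /=; left.
by case: (g w) => [q|] //=; right.
Qed.

Lemma linf_cvg_pointwise (T : topologicalType) (t0 : T) (F : T -> linf R J)
    (C : set (linf R J)) : compact C -> (forall t, C (F t)) ->
  (forall j (e : R), 0 < e -> nbhs t0 [set t | normc (F t0 j - F t j) < e]) ->
  {for t0, continuous F}.
Proof.
move=> cC FC Fj; apply/cvg_ballP => _ /complex_gt0[e e0 ->].
have [js [js0 jsP]] := compact_linf_pointwise (F t0) cC e0.
suff : nbhs t0 [set t | forall p, List.In p js -> normc (F t0 p.1 - F t p.1) < p.2].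
  by apply: filterS => t ht; rewrite linf_ballE; apply: jsP.
elim: js js0 {jsP} => [_|p js ih js0]; first by apply: filterS filterT => t _ p [].
have h1 := Fj p.1 _ (js0 p (or_introl erefl)).
have h2 := ih (fun q qs => js0 q (or_intror qs)).
by apply: filterS (filterI h1 h2) => t [h3 h4] q [<-//|]; exact: h4.
Qed.

(** Evaluations are weakly continuous, so that on C the weak topology also
    coincides with the norm topology. *)
Lemma compact_linf_weak_nbhs (C : set (linf R J)) (x : linf R J) (e : R) :
  compact C -> C x -> 0 < e ->
  nbhs (x : weak (linf R J)) [set y | C y -> sup_normr (x - y) < e].
Proof.
move=> cC Cx e0.
have [js [js0 jsP]] := compact_linf_pointwise x cC e0.
suff : nbhs (x : weak (linf R J))
    [set y | forall p, List.In p js -> normc (x p.1 - (y : linf R J) p.1) < p.2].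
  by apply: filterS => y hy Cy; apply: jsP.
elim: js js0 {jsP} => [_|[j d] js ih js0]; first by apply: filterS filterT => t _ p [].
have /= d0 := js0 (j, d) (or_introl erefl).
have h2 := ih (fun q qs => js0 q (or_intror qs)).
pose ev (f : linf R J) : R[i]^o := f j.
have lev : linear ev by [].
pose Ev : {linear linf R J -> R[i]^o} :=
  HB.pack ev (GRing.isLinear.Build R[i] (linf R J) R[i]^o *:%R ev lev).
have cEv : continuous (Ev : linf R J -> R[i]^o).
  move=> f.
  apply/(@cvgrPdist_lt _ _ _ _ (nbhs_filter (f : linf R J))) => _ /complex_gt0[a a0 ->].
  have a0' : 0 < a%:C%C by rewrite ltcR.
  apply: (@filterS _ _ (nbhs_filter (f : linf R J))) (nbhsx_ballx f _ a0') => h.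
  rewrite linf_ballE => fh.
  by rewrite normr_normc ltcR; exact: le_lt_trans (normc_le_sup (f - h) j) fh.
have d0' : 0 < d%:C%C by rewrite ltcR.
have nb := nbhsx_ballx (ev x) _ d0'.
have h1 : nbhs (x : weak (linf R J)) [set y | ball (ev x) d%:C%C (ev y)].
  exact: (continuous_nbhs (@dual_eval_continuous _ _ (exist _ Ev cEv) x) nb).
apply: filterS (filterI h1 h2) => y [h3 h4] q [<-|]; last exact: h4.
by move: h3; rewrite /= -ball_normE /= normr_normc ltcR.
Qed.
End pointwise_compact.

Section AP_translates.
Variables (R : realType) (S : semitopologicalSemigroupType).
Implicit Types f : linf R S.

Lemma Cb_ltransl (s : S) f : Cb f -> Cb (ltransl s f).
Proof.
move=> cf t; apply: (@continuous_comp S S R[i]^o (fun t => (s * t)%g) f).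
  exact: semitop_mull_continuous.
exact: cf.
Qed.

Lemma AP_range f (s : S) : AP f ->
  (closure (range (fun s : S => ltransl s f)) `&` @Cb R S) (ltransl s f).
Proof.
move=> [cf _]; split; last exact: Cb_ltransl.
by apply: subset_closure; exists s.
Qed.

Lemma ltranslM (s t : S) f : ltransl s (ltransl t f) = ltransl (t * s)%g f.
Proof. by apply/val_inj/funext => u /=; rewrite mulgA. Qed.

Lemma AP_ltransl (s : S) f : AP f -> AP (ltransl s f).
Proof.
move=> [cf kf]; split; first exact: Cb_ltransl.
apply: (subclosed_compact _ kf).
  by apply: closedI; [exact: closed_closure|exact: Cb_closed].
move=> g [clg cg]; split=> //; apply: closure_subset clg => _ [t _ <-].
by exists (s * t)%g => //; rewrite ltranslM.
Qed.

(** Translation is continuous for pointwise convergence, and the translates of f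
    stay in a norm compact set. *)
Lemma ltransl_continuous f : AP f -> continuous (fun s : S => ltransl s f).
Proof.
move=> APf s; have [cf kf] := APf.
apply: (linf_cvg_pointwise kf) => [t|u e e0]; first exact: AP_range.
have nb := Cb_near (s * u)%g cf e0.
exact: (@semitop_mulr_continuous S u s _ nb).
Qed.

Lemma AP_finite_net f (e : R) : AP f -> 0 < e ->
  exists gs : seq (linf R S), forall s, exists2 g, g \in gs &
    sup_normr (g - ltransl s f) < e.
Proof.
move=> APf e0; have [cf kf] := APf; have e0' : 0 < e%:C%C by rewrite ltcR.
have [g _|gs [_ gsP]] := @compact_subcover _ _ (fun g => ball g e%:C%C) kf.
  exact: nbhsx_ballx.
exists gs => s; have [g ggs] := gsP _ (AP_range s APf).
by rewrite linf_ballE; exists g.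
Qed.
End AP_translates.

(** * Fixed points give invariant means *)

(** phi enumerates a totally bounded family of almost periodic functions on which
    left translation acts through the index map sigma. *)
Section mean_representation.
Variables (R : realType) (S : semitopologicalSemigroupType).
Variables (J : Type) (phi : J -> linf R S) (sigma : S -> J -> J).
Hypothesis APphi : forall j, AP (phi j).
Hypothesis phi_ltransl : forall s j, ltransl s (phi j) = phi (sigma s j).
Hypothesis sigmaM : forall s t j, sigma t (sigma s j) = sigma (s * t)%g j.
Hypothesis phi_net : forall e : R, 0 < e -> exists gs : seq (linf R S),
  forall j, exists2 g, g \in gs & sup_normr (g - phi j) < e.

Local Notation functionals := {ptws linf R S -> R[i]^o}.
Local Notation E := (linf R J).

(** The default value 0 is used when m is not bounded on the family. *)
Definition restrict_mean (m : functionals) : E := insubd 0 (fun j => m (phi j)).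
Local Notation T := restrict_mean.

Lemma mean_subr m f g : @is_mean R S m -> m (f - g) = m f - m g.
Proof.
move=> [mD _ _]; have := mD (-1) g f.
by rewrite scaleN1r addrC => ->; rewrite mulN1r addrC.
Qed.

Lemma restrict_meanE m j : is_mean m -> T m j = m (phi j).
Proof.
move=> mm; rewrite /restrict_mean val_insubd ifT//.
have [_ mle _] := mm; have [gs gsP] := phi_net ltr01.
apply/asboolP; exists (1 + \sum_(g <- gs) sup_normr g) => i.
apply: (le_trans (mle _)); apply: sup_normr_le => [|s].
  by rewrite addr_ge0// sumr_ge0// => g _; exact: sup_normr_ge0.
have [g ggs gi] := gsP i.
have h1 := le_lt_trans (normc_le_sup (g - phi i) s) gi.
rewrite linf_subE normcB_sym in h1.
have h2 := le_normcD (phi i s - g s) (g s); rewrite subrK in h2.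
have h3 := normc_le_sup g s.
have : sup_normr g <= \sum_(g <- gs) sup_normr g.
  rewrite (big_rem g)//= lerDl sumr_ge0// => k _; exact: sup_normr_ge0.
lra.
Qed.

(** Closeness of two means on a finite net of the family implies closeness on the
    whole family, as means are 1-Lipschitz. *)
Lemma restrict_mean_continuous : {within @means R S, continuous T}.
Proof.
apply/subspace_continuousP => m mm; apply/cvg_ballP => _ /complex_gt0[e e0 ->].
have e4 : 0 < e / 4 by rewrite divr_gt0.
have [gs gsP] := phi_net e4.
suff : nbhs m [set m' : functionals | forall g, g \in gs -> normc (m g - m' g) < e / 4].
  move=> h; have {}h : within (@means R S) (nbhs m)
      [set m' : functionals | @means R S m' /\ forall g, g \in gs -> normc (m g - m' g) < e / 4].
    by apply: filterS h => m' hm' mm'.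
  apply: filterS h => m' [mm' hm']; rewrite linf_ballE.
  apply: (@le_lt_trans _ _ (3 * (e / 4))); last by lra.
  apply: sup_normr_le => [|j]; first by rewrite mulr_ge0// ltW.
  rewrite linf_subE !restrict_meanE//.
  have [g ggs gj] := gsP j.
  have h1 := hm' g ggs.
  have [_ mle _] := mm; have [_ mle' _] := mm'.
  have := mle (g - phi j); have := mle' (g - phi j).
  rewrite !mean_subr// => h2 h3.
  have := le_normcD (m (phi j) - m g) (m g - m' g).
  rewrite addrA subrK (normcB_sym (m (phi j)) (m g)) => h4.
  have := le_normcD (m (phi j) - m' g) (m' g - m' (phi j)).
  rewrite addrA subrK => h5; lra.
elim: gs {gsP} => [|g gs ih]; first by apply: filterS filterT => m' _ g.
apply: filterS (filterI (functional_nbhs m g e4) ih) => m' [h1 h2] k.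
by rewrite inE => /orP[/eqP->|/h2].
Qed.

Definition mean_image : set E := T @` @means R S.
Local Notation K := mean_image.

Lemma mean_image_compact : compact K.
Proof. exact: continuous_compact restrict_mean_continuous (@means_compact R S). Qed.

Lemma mean_image_weak_compact : compact (K : set (weak E)).
Proof.
have := @continuous_compact E (weak E) (fun x => x) K
  (continuous_subspaceT (@to_weak_continuous _ E)) mean_image_compact.
by rewrite image_id.
Qed.

Lemma pull_subproof (s : S) (x : E) : (fun j => x (sigma s j)) \in @linf_pred R J.
Proof. by have [M xM] := linfP x; apply/asboolP; exists M. Qed.

(** The action of S, which corresponds to m |-> m \o ltransl s ([pull_restrict]). *)
Definition pull (s : S) (x : E) : E := Linf (pull_subproof s x).

Lemma pull_restrict s m : is_mean m -> pull s (T m) = T (m \o ltransl s).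
Proof.
move=> mm; apply/val_inj/funext => j /=.
by rewrite [RHS](restrict_meanE j (ltransl_mean s mm)) restrict_meanE//= phi_ltransl.
Qed.

Lemma pull_mean_image s x : K x -> K (pull s x).
Proof.
move=> [m mm <-]; rewrite pull_restrict//; exists (m \o ltransl s) => //.
exact: ltransl_mean.
Qed.

Lemma pull_le s x y : sup_normr (pull s x - pull s y) <= sup_normr (x - y).
Proof.
apply: sup_normr_le => [|j]; first exact: sup_normr_ge0.
exact: (normc_le_sup (x - y) (sigma s j)).
Qed.

Lemma mean_image_convex : convex_set (K : set (convex_lmodType E)).
Proof.
move=> x y l; rewrite !inE => -[m mm <-] [m' mm' <-].
have [mD mle m1] := mm; have [mD' mle' m1'] := mm'.
have [r [r0 r1 lE]] : exists r : R, [/\ 0 <= r, r <= 1 & l%:num = r%:C%C].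
  have l0 : 0 <= l%:num by []. have l1 : l%:num <= 1 by [].
  exists (Re l%:num); have lE : l%:num = (Re l%:num)%:C%C by rewrite RRe_real// ger0_real.
  by rewrite -!lecR -lE.
pose n := fun f : linf R S => r%:C%C * m f + (1 - r)%:C%C * m' f.
have mn : is_mean n.
  split.
  - by move=> a f g; rewrite /n mD mD'; ring.
  - move=> f; apply: (le_trans (le_normcD _ _)).
    rewrite !normcM !normcR !ger0_norm ?subr_ge0//.
    have := ler_wpM2l r0 (mle f).
    have r1' : 0 <= 1 - r by lra.
    by have := ler_wpM2l r1' (mle' f); lra.
  - by rewrite /n m1 m1' rmorphB rmorph1; ring.
exists n => //; apply/val_inj/funext => j.
rewrite [LHS](restrict_meanE j mn) /conv/= /unstable.onem lE.
transitivity (r%:C%C * T m j + (1 - r%:C%C) * T m' j); last by [].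
by rewrite !restrict_meanE// /n rmorphB rmorph1.
Qed.

(** [pull s] is nonexpansive for the norm, and on the norm compact set K the weak
    and norm uniformities agree. *)
Lemma mean_image_equicontinuous : weakly_equicontinuous K pull.
Proof.
move=> x D eD.
have [Kx|nKx] := pselect (K x); last first.
  have h : globally [set x] [set y : E | forall s, [set: S] s ->
      D (pull s x : weak E, pull s y : weak E)].
    by move=> y -> s _; exact: entourage_refl.
  rewrite (@nbhs_subspace_out (weak E) K x nKx) in h.
  exact: h.
have [z Kz B eB|W eW WP] := @equicontinuous_on_unif E (weak E) unit K
    (fun _ x => x) D mean_image_compact _ eD.
  have /nbhsP[B' eB' B'B] := @to_weak_continuous _ E z _ (nbhs_entourage (z : weak E) eB).
  apply: filterS (nbhs_entourage z eB') => y zy Ky _.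
  by have := B'B y zy; rewrite /xsection/= inE.
move: eW; rewrite -entourage_ballE => -[_ /= /complex_gt0[e e0 ->] eW].
have h : within (K : set (weak E)) (nbhs (x : weak E)) [set y : E | forall s, [set: S] s ->
    D (pull s x : weak E, pull s y : weak E)].
  have := compact_linf_weak_nbhs mean_image_compact Kx e0.
  apply: filterS => y xy Ky s _; have {}xy := xy Ky.
  apply: (WP _ _ _ _ _ tt); [exact: pull_mean_image|exact: pull_mean_image|].
  by apply: eW; rewrite /= linf_ballE; exact: le_lt_trans (pull_le s x y) xy.
rewrite (@nbhs_subspace_in (weak E) K x Kx) in h.
exact: h.
Qed.

Lemma pull_weakly_separately_continuous : weakly_separately_continuous K pull.
Proof.
split=> [s|_ [m mm <-]].
  move=> x; have [Kx|nKx] := pselect (K x); last first.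
    move=> B nB; have h : globally [set x] (pull s @^-1` B).
      by move=> y ->; exact: nbhs_singleton nB.
    rewrite (@nbhs_subspace_out (weak E) K x nKx) in h.
    exact: h.
  move=> B /nbhsP[D eD DB].
  have := mean_image_equicontinuous x eD.
  apply: filterS => y /(_ s I) xy; apply: DB.
  by rewrite /xsection/= inE.
move=> s; apply: (@continuous_comp S E (weak E) (fun s => pull s (T m)) (fun x => x)).
  apply: (linf_cvg_pointwise mean_image_compact).
    by move=> t; apply: pull_mean_image; exists m.
  move=> j e e0; have e0' : 0 < e%:C%C by rewrite ltcR.
  have nb := nbhsx_ballx (ltransl s (phi j)) _ e0'.
  have h : nbhs s [set t | ball (ltransl s (phi j)) e%:C%C (ltransl t (phi j))].
    exact: (continuous_nbhs (ltransl_continuous (APphi j) (x := s)) nb).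
  apply: filterS h => t /=; rewrite linf_ballE => st.
  rewrite !restrict_meanE// -!phi_ltransl -mean_subr//.
  by have [_ mle _] := mm; apply: le_lt_trans (mle _) st.
exact: to_weak_continuous.
Qed.

Lemma invariant_mean_of_fixed_point (s0 : S) : fixed_point_property_over R[i] S ->
  exists2 m : functionals, is_mean m & forall s j, m (ltransl s (phi j)) = m (phi j).
Proof.
move=> fpp; have [|||||||_ [m mm <-] mfix] := fpp E K pull.
- by exists (T (fun f => f s0)); exists (fun f => f s0) => //; exact: eval_mean.
- exact: mean_image_weak_compact.
- exact: mean_image_convex.
- split; first by move=> s x; exact: pull_mean_image.
  by move=> s t x _; apply/val_inj/funext => j /=; rewrite sigmaM.
- exact: pull_weakly_separately_continuous.
- exact: mean_image_equicontinuous.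
- move=> s x y _ _; rewrite !linf_normE lecR; exact: pull_le.
exists m => // s j; have := congr1 (fun x : E => x j) (mfix s).
by rewrite /= !restrict_meanE// phi_ltransl.
Qed.
End mean_representation.

Section finite_families.
Variables (R : realType) (S : semitopologicalSemigroupType).

(** The index None adjoins an identity to S, so that the family contains the f in
    fs together with their translates.  Without it, a fixed point would only
    satisfy m (ltransl (t * s) f) = m (ltransl t f). *)
Lemma finite_invariant_mean (s0 : S) (fs : seq (linf R S)) :
  fixed_point_property_over R[i] S -> (forall f, f \in fs -> AP f) ->
  exists2 m : linf R S -> R[i], is_mean m &
    forall f s, f \in fs -> m (ltransl s f) = m f.
Proof.
move=> fpp APfs.
pose J := (option S * 'I_(size fs))%type.
pose base (j : J) := tnth (in_tuple fs) j.2.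
have APb j : AP (base j) by apply: APfs; exact: mem_tnth.
pose phi (j : J) := if j.1 is Some t then ltransl t (base j) else base j.
pose sigma (s : S) (j : J) : J :=
  (Some (if j.1 is Some t then (t * s)%g else s), j.2).
have [|||e e0|||m mm minv] := @invariant_mean_of_fixed_point R S J phi sigma.
- by move=> [[t|] i]; rewrite /phi //=; apply: AP_ltransl.
- by move=> s [[t|] i] //; rewrite /phi/= ltranslM.
- by move=> s t [[u|] i] //; rewrite /sigma/= mulgA.
- have /choice[gs gsP] (i : 'I_(size fs)) : exists gs : seq (linf R S),
      forall s, exists2 g, g \in gs & sup_normr (g - ltransl s (tnth (in_tuple fs) i)) < e.
    by apply: AP_finite_net => //; apply: APfs; exact: mem_tnth.
  exists (fs ++ flatten [seq gs i | i <- enum 'I_(size fs)]) => -[[t|] i].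
    have [g ggs gt] := gsP i t; exists g => //.
    rewrite mem_cat; apply/orP; right; apply/flatten_mapP; exists i => //.
    by rewrite mem_enum.
  exists (tnth (in_tuple fs) i); first by rewrite mem_cat mem_tnth.
  apply: le_lt_trans e0; apply: sup_normr_le => // s.
  by rewrite linf_subE /phi/= subrr normc0.
- exact: s0.
- exact: fpp.
exists m => // f s /(@tnthP _ _ (in_tuple fs))[i ->].
exact: (minv s (None, i)).
Qed.

(** For each finite list of almost periodic functions the means that are invariant
    on it form a nonempty closed set; these sets are directed, and the set of all
    means is compact. *)
Theorem lim_of_fixed_point_property (s0 : S) :
  fixed_point_property_over R[i] S ->
  exists m : linf R S -> R[i], left_invariant_mean (@AP R S) m.
Proof.
move=> fpp.
pose inv (fs : seq (linf R S)) := [set m : {ptws linf R S -> R[i]^o} |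
  is_mean m /\ forall f s, f \in fs -> m (ltransl s f) = m f].
have [|_ [fs APfs <-]|_ _ [fs APfs <-] [gs APgs <-]|m mP] := @compact_directed _ (@means R S)
  [set inv fs | fs in [set fs : seq (linf R S) | forall f, f \in fs -> AP f]] (@means_compact R S).
- by exists (inv [::]), [::].
- split; last first.
    by have [m mm minv] := finite_invariant_mean s0 fpp APfs; exists m.
  + by move=> m [].
  move=> m clm; have mm : is_mean m.
    by apply: means_closed; apply: closure_subset clm => n [].
  split=> // f s ffs; apply/eqP; rewrite -subr_eq0; apply/eqP.
  apply: small_eq0 => e e0; have e2 : 0 < e / 2 by rewrite divr_gt0.
  have [n [[_ /(_ f s ffs) ninv] [/= h1 h2]]] := clm _ (filterI
    (functional_nbhs m (ltransl s f) e2) (functional_nbhs m f e2)).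
  rewrite ninv in h1.
  have := le_normcD (m (ltransl s f) - n f) (n f - m f).
  by rewrite addrA subrK (normcB_sym (n f)); lra.
- exists (inv (fs ++ gs)).
    by exists (fs ++ gs) => // f; rewrite mem_cat => /orP[/APfs|/APgs].
  by move=> m [mm minv]; split; split=> // f s fs_; apply: minv;
    rewrite mem_cat fs_ ?orbT.
have [mm _] : inv [::] m by apply: mP; exists [::].
have [mD mle m1] := mm.
exists m; split=> //.
- rewrite /functional_norm; apply: le_anti; apply/andP; split.
    apply: ge_ereal_sup => y [f [_ /=]]; rewrite linf_normE (_ : 1 = 1%:C%C)// lecR.
    by move=> f1 <-; rewrite lee_fin; exact: le_trans (mle f) f1.
  apply: ereal_sup_ubound; exists (linf_cst S 1).
    split; first exact: AP_cst.
    rewrite /= linf_normE (_ : 1 = 1%:C%C)// lecR; apply: sup_normr_le => // s.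
    by rewrite normcR normr1.
  by rewrite m1 (_ : 1 = 1%:C%C)// normcR normr1.
- move=> s f APf; have [|_] := mP (inv [:: f]).
    by exists [:: f] => // g; rewrite inE => /eqP->.
  by apply; rewrite mem_head.
Qed.
End finite_families.

Theorem theorem3p2 (R : realType) (S : semitopologicalSemigroupType)
    (S_nonempty : [set: S] !=set0) :
  (exists m : linf R S -> R[i], left_invariant_mean (@AP R S) m) <->
  fixed_point_property R S.
Proof.
split=> [[m lim]|[_ fpp]]; first exact: fixed_point_property_of_lim lim.
have [s0 _] := S_nonempty; exact: lim_of_fixed_point_property s0 fpp.
Qed.
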